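(* Let $1\le p<\infty$ and $f\in\mathcal S^p$. Then for any $\tau>0$, $n\in\mathbb N$ and $\varphi\in\Phi$, $$E_n(f)_p\le C_{n,\varphi,p}(\tau)\,\omega_\varphi\Big(f,\frac{\tau}{n}\Big)_p,$$ where $$C_{n,\varphi,p}(\tau):=\Big(\inf_{v\in V(\tau)}\frac{v(\tau)-v(0)}{I_{n,\varphi,p}(\tau,v)}\Big)^{1/p},\qquad I_{n,\varphi,p}(\tau,v):=\inf_{k\in\mathbb N,\,k\ge n}\int_0^\tau\varphi^p\Big(\frac{ku}{n}\Big)\,dv(u).$$ There exists a function $v^*\in V(\tau)$ at which the infimum over $v\in V(\tau)$ in the definition of $C_{n,\varphi,p}(\tau)$ is attained. Moreover, the inequality is unimprovable on the set of all non-constant $f\in\mathcal S^p$: $$K_{n,\varphi}(\tau)_p:=\sup_{f\in\mathcal S^p,\,f\not\equiv\mathrm{const}}\frac{E_n(f)_p}{\omega_\varphi(f,\tau/n)_p}=C_{n,\varphi,p}(\tau).$$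
   Context: $L$ is the space of $2\pi$-periodic Lebesgue integrable functions, with Fourier coefficients $\widehat f(k)=(2\pi)^{-1}\int_0^{2\pi}f(x)e^{-\mathrm{i}kx}\,dx$, $k\in\mathbb Z$. For $1\le p<\infty$, $\mathcal S^p$ is the space of $f\in L$ with finite norm $\|f\|_p=(\sum_{k\in\mathbb Z}|\widehat f(k)|^p)^{1/p}$; for any complex sequence $c=\{c_k\}$, $\|c\|_p=(\sum_k|c_k|^p)^{1/p}$. $E_n(f)_p=\inf\{\|f-t\|_p:t\in\mathcal T_{n-1}\}$, $\mathcal T_{n-1}$ the trigonometric polynomials $\sum_{|k|\le n-1}c_ke^{\mathrm{i}kx}$. $\Phi$ is the set of all continuous, bounded, nonnegative, even functions $\varphi:\mathbb R\to\mathbb R$ with $\varphi(0)=0$ such that $\{t:\varphi(t)=0\}$ has Lebesgue measure zero. For $\varphi\in\Phi$, $h\in\mathbb R$, $\Delta_h^\varphi f$ is the sequence $\{\varphi(kh)\widehat f(k)\}_{k\in\mathbb Z}$ and $\omega_\varphi(f,\delta)_p=\sup_{|h|\le\delta}\|\Delta_h^\varphi f\|_p$. $V(\tau)$ is the set of bounded nondecreasing functions $v$ on $[0,\tau]$ that are not constant on $[0,\tau]$; integrals are Lebesgue–Stieltjes. *)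

(* Defs.v *)
From HB Require Import structures.
From mathcomp Require Import all_boot all_order all_algebra.
From mathcomp Require Import all_classical all_reals all_analysis.
From mathcomp.real_closed Require Import complex.

Set Implicit Arguments.
Unset Strict Implicit.
Unset Printing Implicit Defensive.

Import Order.TTheory GRing.Theory Num.Theory.
Import numFieldNormedType.Exports.

Local Open Scope classical_set_scope.
Local Open Scope ring_scope.
Local Open Scope complex_scope.

Section Defs.
Variable R : realType.

Definition expi (t : R) : R[i] := Complex (cos t) (sin t).

Definition cabs (z : R[i]) : R := Normc.normc z.

Definition Lper (f : R -> R[i]) : Prop :=
  (forall x, f (x + 2 * pi) = f x) /\
  lebesgue_measure.-integrable `[0, 2 * pi] (fun x => (complex.Re (f x))%:E) /\
  lebesgue_measure.-integrable `[0, 2 * pi] (fun x => (complex.Im (f x))%:E).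

Definition cint02pi (g : R -> R[i]) : R[i] :=
  Complex (Rintegral lebesgue_measure `[0, 2 * pi] (fun x => complex.Re (g x)))
          (Rintegral lebesgue_measure `[0, 2 * pi] (fun x => complex.Im (g x))).

Definition fcoef (f : R -> R[i]) (k : int) : R[i] :=
  ((2 * pi)^-1)%:C * cint02pi (fun x => f x * expi (- (k%:~R * x))).

Definition lpnorm (p : R) (c : int -> R[i]) : \bar R :=
  poweR (\esum_(k in [set: int]) ((cabs (c k)) `^ p)%:E) p^-1.

Definition Spnorm (p : R) (f : R -> R[i]) : \bar R := lpnorm p (fcoef f).

Definition Sp (p : R) (f : R -> R[i]) : Prop :=
  Lper f /\ (\esum_(k in [set: int]) ((cabs (fcoef f k)) `^ p)%:E < +oo)%E.

Definition trigpoly (m : nat) : set (R -> R[i]) :=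
  [set t | exists c : int -> R[i],
     t = fun x => \sum_(j < (2 * m).+1)
                    c (j%:Z - m%:Z) * expi ((j%:Z - m%:Z)%:~R * x)].

Definition En (n : nat) (p : R) (f : R -> R[i]) : \bar R :=
  ereal_inf [set Spnorm p (fun x => f x - t x) | t in trigpoly n.-1].

Definition Phi : set (R -> R) :=
  [set phi | continuous phi /\
             (exists M : R, forall t, phi t <= M) /\
             (forall t, 0 <= phi t) /\
             (forall t, phi (- t) = phi t) /\
             phi 0 = 0 /\
             lebesgue_measure.-negligible [set t | phi t = 0]].

Definition Delta (phi : R -> R) (h : R) (f : R -> R[i]) : int -> R[i] :=
  fun k => (phi (k%:~R * h))%:C * fcoef f k.

Definition omega (phi : R -> R) (p : R) (f : R -> R[i]) (delta : R) : \bar R :=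
  ereal_sup [set lpnorm p (Delta phi h f) | h in [set h : R | `|h| <= delta]].

Definition Vset (tau : R) : set (R -> R) :=
  [set v : R -> R | {in `[0, tau]&, {homo v : x y / x <= y}} /\
           (exists M : R, forall x, x \in `[0, tau] -> `|v x| <= M) /\
           (exists x y, x \in `[0, tau] /\ y \in `[0, tau] /\ v x != v y)].

(** right-continuous normalisation of v on [0,tau], extended by constants:
    F = v(0) on (-oo,0), F(x) = v(x+) on [0,tau), F = v(tau) on [tau,+oo).
    Its Lebesgue-Stieltjes measure restricted to [0,tau] is the
    Lebesgue-Stieltjes measure dv on [0,tau] (total mass v(tau)-v(0)). *)
Definition LSreg (tau : R) (v : R -> R) : R -> R := fun x =>
  if x < 0 then v 0
  else if tau <= x then v tau
  else inf [set v y | y in `]x, tau]].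

Definition mkcumul (F : R -> R) (h1 : {homo F : x y / x <= y})
  (h2 : right_continuous F) : cumulative R R :=
  HB.pack_for (cumulative R R) F (isCumulative.Build R _ R F h1 h2).

(** the Lebesgue-Stieltjes measure dv (the default branch is never used
    for v in V(tau), where LSreg tau v is nondecreasing and right-continuous) *)
Definition LSmeasure (tau : R) (v : R -> R) :
    set (measurableTypeR R) -> \bar R :=
  match pselect ({homo LSreg tau v : x y / x <= y} /\
                 right_continuous (LSreg tau v)) with
  | left H => lebesgue_stieltjes_measure (mkcumul (proj1 H) (proj2 H))
  | right _ => fun _ => 0%E
  end.

Definition LSint (tau : R) (v : R -> R) (g : R -> R) : \bar R :=
  let D : set R := `[0, tau]%classic in
  (\int[LSmeasure tau v]_(u in D) (g u)%:E)%E.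

Definition Inphi (n : nat) (phi : R -> R) (p tau : R) (v : R -> R) : \bar R :=
  ereal_inf [set LSint tau v (fun u => (phi (k%:R * u / n%:R)) `^ p)
            | k in [set k : nat | (n <= k)%N]].

Definition Cratio (n : nat) (phi : R -> R) (p tau : R) (v : R -> R) : \bar R :=
  ((v tau - v 0)%:E / Inphi n phi p tau v)%E.

Definition Cconst (n : nat) (phi : R -> R) (p tau : R) : \bar R :=
  poweR (ereal_inf [set Cratio n phi p tau v | v in Vset tau]) p^-1.

Definition nonconst (f : R -> R[i]) : Prop :=
  ~ exists c : R[i],
      {ae lebesgue_measure, forall x : R, x \in `[0, 2 * pi] -> f x = c}.

Definition Kconst (n : nat) (phi : R -> R) (p tau : R) : \bar R :=
  ereal_sup [set (En n p f / omega phi p f (tau / n%:R))%E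
            | f in [set f | Sp p f /\ nonconst f]].

End Defs.

(* Main.v *)
(** Weak duality: integrating the bound [sum_k |f_k|^p phi^p(k u / n) <= omega^p]
    against [dv(u)] gives [E_n(f)^p I(v) <= omega^p (v(tau) - v(0))] for every [v],
    hence [K <= C].

    Conversely, testing [K] on the polynomials [sum_k a_k^(1/p) e^(ikx)],
    [k >= n], [a_k >= 0], shows that for [mu < K^(-p)] no convex combination of
    the functions [g_k(u) = phi^p(k u / n)] stays below [mu] on [[0, tau]].
    Blackwell's approachability strategy turns this into finite empirical
    measures whose means of [g_n, ..., g_(n+N)] are at least [K^(-p) - 1/(N+1)].
    Their distribution functions converge pointwise along an ultrafilter, and
    the limit [w] is a probability distribution with [I(w) >= K^(-p)], i.e. its
    ratio is at most [K^p <= C^p]: it is optimal and [K = C]. *)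
Require Import Defs.
From HB Require Import structures.
From mathcomp Require Import all_boot all_order all_algebra.
From mathcomp Require Import all_classical all_reals all_analysis.
From mathcomp Require Import measurable_realfun.
From mathcomp.real_closed Require Import complex.
From mathcomp Require Import ring lra zify.
Set Implicit Arguments.
Unset Strict Implicit.
Unset Printing Implicit Defensive.
Import Order.TTheory GRing.Theory Num.Theory.
Import numFieldNormedType.Exports.
Local Open Scope classical_set_scope.
Local Open Scope ring_scope.

(** * Approachability *)

(** The norm of [Sp] sees only the moduli of the Fourier coefficients, so the p-th power of [En] is
    the tail sum over [n <= |k|]. The extremal problem is thus a zero-sum game with payoff [g_k(u)]:
    one player weights frequencies, the other puts mass on [[0, tau]], and neither has finitely many
    moves. Separation and weak compactness of measures would be the usual route. Approachability
    needs only sums of squares and returns finite sequences of points; an ultrafilter then gives the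
    limit at every point at once, without extracting subsequences.

    The price is paid in the limit: a pointwise limit of distribution functions need not be
    right-continuous, while the integral sees its regularisation [LSreg]. The two are compared at
    points slightly to the right of a grid. Sample points near 0 escape this grid, which is harmless
    because every [g_k] is continuous and vanishes at 0. *)

(** The squared distance of [s] to the negative half-line has derivative [2 * Num.max 0 s], which is
    2-Lipschitz; this is the resulting Taylor bound. *)
Lemma sqr_max0D_le (R : realType) (s r : R) :
  Num.max 0 (s + r) ^+ 2 <= Num.max 0 s ^+ 2 + 2 * (Num.max 0 s * r) + r ^+ 2.
Proof.
by case: (leP 0 (s + r)) => h1; case: (leP 0 s) => h2; nra.
Qed.

(* Blackwell's approachability strategy: each new point answers the weights
   given by the positive parts of the accumulated deficits. *)
Lemma approachability (R : realType) (X : eqType) (P : set X) (K : nat)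
    (g : 'I_K -> X -> R) (mu B : R) :
  (forall k x, P x -> (mu - g k x) ^+ 2 <= B) ->
  (forall a : 'I_K -> R, (forall k, 0 <= a k) ->
     exists2 x, P x & mu * \sum_k a k <= \sum_k a k * g k x) ->
  forall T, exists s : seq X, [/\ size s = T, forall x, x \in s -> P x &
    \sum_k Num.max 0 (\sum_(x <- s) (mu - g k x)) ^+ 2 <= T%:R * (K%:R * B)].
Proof.
move=> gB ga; elim => [|T [s [sT sP IH]]].
  exists [::]; split=> //; rewrite mul0r big1// => k _.
  by rewrite big_nil maxxx expr0n.
pose S k := \sum_(x <- s) (mu - g k x).
have max0S k : 0 <= Num.max 0 (S k) by rewrite le_max lexx.
have [x Px xa] := ga _ max0S.
exists (x :: s); split => [|y|]; first by rewrite /= sT.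
  by rewrite inE => /orP[/eqP->//|/sP].
have H k : Num.max 0 (\sum_(y <- x :: s) (mu - g k y)) ^+ 2 <=
    Num.max 0 (S k) ^+ 2 + 2 * (Num.max 0 (S k) * (mu - g k x)) + B.
  rewrite big_cons addrC (le_trans (sqr_max0D_le _ _))// lerD2l; exact: gB.
apply: (le_trans (ler_sum _ (fun k _ => H k))).
rewrite !big_split/= sumr_const card_ord -[B *+ K]mulr_natl.
rewrite -(natr1 T) mulrDl mul1r lerD2r -[leRHS]addr0 lerD// -mulr_sumr.
(* The cross term is [mu * \sum_k a k - \sum_k a k * g k x] with [a k = Num.max 0 (S k)]; [x] was
   chosen to make it nonpositive. Only the squares remain, at most [K * B] per round. *)
rewrite pmulr_rle0// (eq_bigr (fun k => mu * Num.max 0 (S k) - Num.max 0 (S k) * g k x)).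
  by rewrite sumrB -mulr_sumr subr_le0.
by move=> k _; rewrite mulrBr [mu * _]mulrC.
Qed.

(** The potential grows linearly in the number [T] of rounds, whereas a mean deficit above [e] would
    make it exceed [(e * T) ^+ 2]. Hence any [T] beyond [K * B / e ^+ 2] will do. *)
Lemma approximate_minimax (R : realType) (X : eqType) (P : set X) (K : nat)
    (g : 'I_K -> X -> R) (mu B e : R) :
  (forall k x, P x -> (mu - g k x) ^+ 2 <= B) ->
  (forall a : 'I_K -> R, (forall k, 0 <= a k) ->
     exists2 x, P x & mu * \sum_k a k <= \sum_k a k * g k x) ->
  0 < e ->
  exists s : seq X, [/\ (0 < size s)%N, forall x, x \in s -> P x &
    forall k, (mu - e) * (size s)%:R <= \sum_(x <- s) g k x].
Proof.
move=> gB ga e0.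
pose T := (Num.truncn (K%:R * B / e ^+ 2)).+1.
have [s [sT sP sB]] := approachability gB ga T.
exists s; split => [|//|k]; first by rewrite sT.
have HT : K%:R * B <= e ^+ 2 * T%:R.
  by rewrite [leRHS]mulrC -ler_pdivrMr ?exprn_gt0//; exact/ltW/truncnS_gt.
have: Num.max 0 (\sum_(x <- s) (mu - g k x)) ^+ 2 <= (e * T%:R) ^+ 2.
  apply: (@le_trans _ _ (T%:R * (K%:R * B))); last first.
    by rewrite exprMn [T%:R ^+ 2]expr2 [leRHS]mulrA [leRHS]mulrC; exact: ler_wpM2l.
  apply: le_trans sB; rewrite (bigD1 k)//= lerDl sumr_ge0// => i _.
  exact: sqr_ge0.
rewrite ler_sqr ?nnegrE; [|by rewrite le_max lexx|by rewrite mulr_ge0// ltW].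
rewrite ge_max sumrB big_const_seq count_predT iter_addr addr0 -mulr_natr sT.
by move=> /andP[_]; lra.
Qed.

(** * The Lebesgue-Stieltjes measure of [v] *)

Section lebesgue_stieltjes.
Context {R : realType}.
Variable tau : R.
Hypothesis tau0 : 0 < tau.

Lemma VsetP (v : R -> R) x y : Vset tau v -> 0 <= x -> x <= y -> y <= tau ->
  v x <= v y.
Proof.
move=> [vh _] x0 xy yt; apply: vh => //; rewrite in_itv/=.
  by rewrite x0 (le_trans xy).
by rewrite (le_trans x0).
Qed.

Lemma Vset_lt (v : R -> R) : Vset tau v -> v 0 < v tau.
Proof.
move=> Vv; rewrite lt_neqAle (VsetP Vv) ?lexx ?(ltW tau0)// andbT.
apply/eqP => v0t; have [_ [_ [x [y [xI [yI /eqP]]]]]] := Vv; apply.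
have E z : z \in `[0, tau] -> v z = v 0.
  rewrite in_itv/= => /andP[z0 zt]; apply/eqP; rewrite eq_le {1}v0t.
  by rewrite !(VsetP Vv).
by rewrite !E.
Qed.

Lemma LSreg_inf (v : R -> R) x : 0 <= x -> x < tau ->
  LSreg tau v x = inf [set v y | y in `]x, tau]].
Proof. by move=> x0 xt; rewrite /LSreg ltNge x0/= leNgt xt. Qed.

Lemma LSreg_has_inf (v : R -> R) x : Vset tau v -> 0 <= x -> x < tau ->
  has_inf [set v y | y in `]x, tau]].
Proof.
move=> Vv x0 xt; split.
  by exists (v tau), tau => //=; rewrite in_itv/= xt lexx.
exists (v 0) => z [y /=]; rewrite in_itv/= => /andP[xy yt] <-.
by rewrite (VsetP Vv)// (le_trans x0)// ltW.
Qed.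

Lemma LSreg_le (v : R -> R) x y : Vset tau v -> 0 <= x -> x < y -> y <= tau ->
  LSreg tau v x <= v y.
Proof.
move=> Vv x0 xy yt; rewrite LSreg_inf ?(lt_le_trans xy)//.
apply: ge_inf; first by have [] := LSreg_has_inf Vv x0 (lt_le_trans xy yt).
by exists y => //=; rewrite in_itv/= xy.
Qed.

Lemma LSreg_ge (v : R -> R) x : Vset tau v -> 0 <= x -> x <= tau ->
  v x <= LSreg tau v x.
Proof.
move=> Vv x0; rewrite le_eqVlt => /predU1P[->|xt].
  by rewrite /LSreg ltNge (ltW tau0)/= lexx.
rewrite LSreg_inf//; apply: lb_le_inf.
  by have [] := LSreg_has_inf Vv x0 xt.
move=> z [y /=]; rewrite in_itv/= => /andP[xy yt] <-.
by rewrite (VsetP Vv)// ltW.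
Qed.

Lemma LSreg_lt0 (v : R -> R) x : x < 0 -> LSreg tau v x = v 0.
Proof. by rewrite /LSreg => ->. Qed.

Lemma LSreg_ge_tau (v : R -> R) x : tau <= x -> LSreg tau v x = v tau.
Proof. by move=> tx; rewrite /LSreg ltNge (le_trans (ltW tau0) tx)/= tx. Qed.

Lemma LSreg_bounds (v : R -> R) x : Vset tau v -> 
  v 0 <= LSreg tau v x <= v tau.
Proof.
move=> Vv; have v0t := ltW (Vset_lt Vv).
have [x0|x0] := ltP x 0; first by rewrite LSreg_lt0// lexx.
have [tx|xt] := leP tau x; first by rewrite LSreg_ge_tau// lexx andbT.
rewrite (le_trans _ (LSreg_ge Vv x0 (ltW xt))) ?(VsetP Vv) ?(ltW xt)//=.
exact: LSreg_le.
Qed.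

Lemma LSreg_homo (v : R -> R) : Vset tau v -> {homo LSreg tau v : x y / x <= y}.
Proof.
move=> Vv x y; rewrite le_eqVlt => /predU1P[->//|xy].
have [x0|x0] := ltP x 0.
  by rewrite LSreg_lt0//; case/andP: (LSreg_bounds y Vv).
have [ty|yt] := leP tau y.
  by rewrite (LSreg_ge_tau v ty)//; case/andP: (LSreg_bounds x Vv).
apply: (le_trans (LSreg_le Vv x0 xy (ltW yt))).
by apply: LSreg_ge; rewrite ?ltW// (le_lt_trans x0).
Qed.

(** By monotonicity one point [z > x] with value within [e] is enough. Inside [[0, tau[] the infimum
    provides [y > x] with [v y] that small, and [LSreg_le] transfers this to any [z] strictly
    between [x] and [y]. *)
Lemma LSreg_right_continuous (v : R -> R) : Vset tau v ->
  right_continuous (LSreg tau v).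
Proof.
move=> Vv x; apply/cvgrPdist_le => /= e e0.
suff [z xz Hz] : exists2 z, x < z & LSreg tau v z <= LSreg tau v x + e.
  near=> y.
  rewrite distrC ger0_norm; last first.
    by rewrite subr_ge0 (LSreg_homo Vv)//; near: y; exact: nbhs_right_ge.
  rewrite lerBlDl (le_trans _ Hz)// (LSreg_homo Vv)//.
  by near: y; exact: nbhs_right_le.
have [x0|x0] := ltP x 0.
  exists (x / 2); first by lra.
  by rewrite !LSreg_lt0 ?lerDl ?ltW//; lra.
have [tx|xt] := leP tau x.
  exists (x + 1); first by rewrite ltrDl.
  have tx1 : tau <= x + 1 by rewrite (le_trans tx)// lerDl.
  by rewrite !LSreg_ge_tau// lerDl ltW.
rewrite [LSreg tau v x]LSreg_inf//.
have [_ [y /= + <-] yx] := inf_adherent e0 (LSreg_has_inf Vv x0 xt).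
rewrite in_itv/= => /andP[xy yt].
exists ((x + y) / 2); first by lra.
by rewrite (le_trans _ (ltW yx))// LSreg_le//; lra.
Unshelve. all: by end_near. Qed.

Lemma LSmeasureE (v : R -> R) : Vset tau v ->
  exists2 F : cumulative R R, F = LSreg tau v :> (R -> R) &
    LSmeasure tau v = lebesgue_stieltjes_measure F.
Proof.
move=> Vv; rewrite /LSmeasure; case: pselect => [H|[]]; last first.
  by split; [exact: LSreg_homo|exact: LSreg_right_continuous].
by exists (mkcumul (proj1 H) (proj2 H)).
Qed.

Lemma lebesgue_stieltjes_measure_itvoc (F : cumulative R R) a b : a <= b ->
  lebesgue_stieltjes_measure F `]a, b]%classic = (F b - F a)%:E.
Proof.
move=> ab; rewrite /lebesgue_stieltjes_measure /measure_extension.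
by rewrite measurable_mu_extE/= ?wlength_itv_bnd//; exact: is_ocitv.
Qed.

(** Half-open intervals []- e, tau]] all have mass [v tau - v 0], since [LSreg] equals [v 0] on the
    negative axis; they shrink to [[0, tau]]. A jump of [v] at 0 is thereby counted as an atom. *)
Lemma LSmeasure_itv (v : R -> R) : Vset tau v ->
  LSmeasure tau v `[0, tau]%classic = (v tau - v 0)%:E.
Proof.
move=> Vv; have [F FE ->] := LSmeasureE Vv.
have H e : 0 < e -> lebesgue_stieltjes_measure F `]- e, tau]%classic = (v tau - v 0)%:E.
  move=> e0; rewrite lebesgue_stieltjes_measure_itvoc; last first.
    by rewrite ltW// (lt_trans _ tau0)// oppr_lt0.
  by rewrite FE LSreg_ge_tau// LSreg_lt0// oppr_lt0.
have -> : `[0, tau]%classic = \bigcap_(i : nat) `]- i.+1%:R^-1, tau]%classic.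
  apply/seteqP; split => [x /= + i _|x /= xI].
    rewrite /= !in_itv/= => /andP[x0 ->]; by rewrite andbT (lt_le_trans _ x0).
  have := xI 0%N Logic.I; rewrite /= !in_itv/= => /andP[_ ->]; rewrite andbT.
  rewrite leNgt; apply/negP => x0.
  have := xI (Num.truncn (- x)^-1) Logic.I; rewrite /= in_itv/= => /andP[+ _].
  rewrite ltrNl; apply/negP; rewrite -leNgt invf_ple ?posrE ?ltr0n ?oppr_gt0//.
  exact/ltW/truncnS_gt.
have /cvg_unique : lebesgue_stieltjes_measure F \o
    (fun i : nat => `]- i.+1%:R^-1, tau]%classic) @ \oo -->
    lebesgue_stieltjes_measure F (\bigcap_(i : nat) `]- i.+1%:R^-1, tau]%classic).
  apply: nonincreasing_cvg_mu => /=.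
  - by rewrite H// ltry.
  - by move=> i; exact: measurable_itv.
  - by apply: bigcap_measurable => // k _; exact: measurable_itv.
  - move=> m n mn; apply/subsetPset => x /=; rewrite !in_itv/= => /andP[+ ->].
    rewrite andbT; apply: le_lt_trans; rewrite lerN2 lef_pV2 ?posrE ?ltr0n//.
    by rewrite ler_nat.
apply => //; rewrite (_ : _ \o _ = cst (v tau - v 0)%:E); first exact: cvg_cst.
by apply/funext => i/=; rewrite H.
Qed.

End lebesgue_stieltjes.

(** * Limits of empirical distributions *)

Lemma bounded_filter_limits (R : realType) (T : Type) (F : nat -> T -> R) (a b : R) :
  (forall N t, a <= F N t <= b) ->
  exists (U : set_system nat) (v : T -> R), [/\ ProperFilter U, \oo `<=` U &
    forall t, F N t @[N --> U] --> v t].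
Proof.
move=> Fab; have [U [UU ooU]] := ultraFilterLemma (eventually_filter).
have H t : exists l : R, F N t @[N --> U] --> l.
  have PU : UltraFilter (F N t @[N --> U]).
    split; first exact: fmap_proper_filter.
    move=> G GF sG; rewrite eqEsubset; split=> // A GA.
    have [//|UA] := in_ultra_setVsetC (F^~ t @^-1` A) UU.
    have GC : G (~` A) by exact: sG.
    by have /(filter_not_empty G) : G set0 by rewrite -(setICr A); exact: filterI.
  have := @segment_compact _ a b; rewrite compact_ultra => /(_ _ PU).
  case; first by apply: (@filterE _ U) => N /=; rewrite in_itv/= Fab.
  by move=> l [_ /= Fl]; exists l.
have [v vP] := choice H.
exists U, v; split => //; exact: ultra_proper.
Qed.

Lemma segment_unif_continuous (R : realType) (g : R -> R) (a b e : R) :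
  continuous g -> 0 < e -> exists2 d, 0 < d &
  forall x y, a <= x <= b -> `|y - x| <= d -> `|g y - g x| <= e.
Proof.
move=> gc e0.
have := @segment_compact R a b; rewrite compact_near_coveringP => nc.
have := nc R (0^'+) (fun d x => forall y, `|y - x| <= d -> `|g y - g x| <= e) _.
case.
  move=> x _.
  have e20 : 0 < e / 2 by rewrite divr_gt0.
  have /cvgrPdist_le/(_ _ e20) := gc x.
  rewrite -nbhs_ballE /= => -[d /= d0 gd].
  have d20 : 0 < d / 2 by rewrite divr_gt0.
  exists (ball x (d / 2), [set r | r < d / 2]) => /=.
    by split; [exact: nbhsx_ballx|exact: nbhs_right_lt].
  move=> [z r] /= [zx rd] y yz.
  have -> : g y - g z = (g x - g z) - (g x - g y) by lra.
  rewrite (le_trans (ler_normB _ _))// (splitr e) lerD// gd//.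
    by rewrite /ball/= in zx *; apply: lt_trans zx _; lra.
  rewrite /ball/= in zx *.
  have -> : x - y = (x - z) - (y - z) by lra.
  apply: (le_lt_trans (ler_normB _ _)).
  by rewrite (splitr d) ltr_leD// (le_trans yz)// ltW.
move=> r /= r0 H.
exists (r / 2); first by rewrite divr_gt0.
move=> x y xab; apply: (H (r / 2)) => //=.
- by rewrite sub0r normrN ger0_norm ?divr_ge0 ?ltW// ltr_pdivrMr// ltr_pMr// ltr1n.
- by rewrite divr_gt0.
Qed.

(* Forcing the value 0 at [x = 0] makes the total mass [v tau - v 0] equal to 1
   even when points sit at 0. *)
Definition empirical_cdf (R : realType) (s : seq R) (x : R) : R :=
  if x <= 0 then 0 else (count (fun u => u <= x) s)%:R / (size s)%:R.

Section empirical_cdf.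
Context {R : realType}.
Implicit Types (s : seq R) (x y : R).

Lemma empirical_cdf01 s x : 0 <= empirical_cdf s x <= 1.
Proof.
rewrite /empirical_cdf; case: ifP => _; first by rewrite lexx ler01.
rewrite divr_ge0//=; have [->|s0] := eqVneq (size s) 0%N.
  by rewrite invr0 mulr0 ler01.
by rewrite ler_pdivrMr ?ltr0n ?lt0n// mul1r ler_nat count_size.
Qed.

Lemma empirical_cdf_homo s : {homo empirical_cdf s : x y / x <= y}.
Proof.
move=> x y xy; have [x0|x0] := leP x 0.
  by rewrite {1}/empirical_cdf x0; case/andP: (empirical_cdf01 s y).
rewrite /empirical_cdf (leNgt x 0) (leNgt y 0) x0 (lt_le_trans x0 xy)/=.
apply: ler_wpM2r; first by rewrite invr_ge0.
rewrite ler_nat; apply: sub_count => u /= ux.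
exact: le_trans xy.
Qed.

Lemma empirical_cdf_increment s x y : 0 < x -> x <= y ->
  empirical_cdf s y - empirical_cdf s x =
  (\sum_(u <- s) ((x < u) && (u <= y))%:R) / (size s)%:R.
Proof.
move=> x0 xy; rewrite /empirical_cdf (leNgt x 0) (leNgt y 0) x0 (lt_le_trans x0 xy)/= -mulrBl.
congr (_ / _); rewrite -!sum1_count !natr_sum.
rewrite [X in X - _]big_mkcond [X in _ - X]big_mkcond/= -sumrB.
apply: eq_bigr => u _; case: (ltP x u) => xu/=.
  by rewrite subr0; case: ifP.
by rewrite (le_trans xu xy) subrr.
Qed.

End empirical_cdf.

(** * Lower bounds on integrals under pointwise limits of distribution functions *)

Section weak_limit.
Context {R : realType}.

Lemma step_sum_le_integral (F : cumulative R R) (g : R -> R) (x c : nat -> R) m :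
  continuous g -> (forall u, 0 <= g u) -> {homo x : i j / (i <= j)%N >-> i <= j} ->
  (forall i, 0 <= c i) ->
  (forall i u, (i < m)%N -> x i < u <= x i.+1 -> c i <= g u) ->
  ((\sum_(i < m) c i * (F (x i.+1) - F (x i)))%:E <=
   \int[lebesgue_stieltjes_measure F]_(u in `]x 0%N, x m]%classic) (g u)%:E)%E.
Proof.
move=> gc g0 xh c0; elim: m => [|m IH] cg.
  by rewrite big_ord0 set_itv_ge ?bnd_simp ?ltxx// integral_set0.
have mg (D : set R) : measurable D ->
    measurable_fun D (EFin \o g).
  move=> mD; apply/measurable_EFinP; apply: measurable_funTS.
  exact: continuous_measurable_fun.
have xm : x 0%N <= x m by exact: xh.
have xS : x m <= x m.+1 by exact: xh.
have -> : `]x 0%N, x m.+1]%classic = `]x 0%N, x m]%classic `|` `]x m, x m.+1]%classic.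
  by rewrite -itv_bndbnd_setU// bnd_simp.
rewrite ge0_integral_setU//=.
- rewrite big_ord_recr/= EFinD; apply: leeD; first by apply: IH => i u im; apply: cg; exact: ltnW.
  rewrite EFinM -lebesgue_stieltjes_measure_itvoc// -integral_cst//.
  apply: ge0_le_integral => //.
  + by move=> u _; rewrite lee_fin.
  + exact: mg.
  + by move=> u /=; rewrite in_itv/= => uI; rewrite lee_fin (cg m).
- by apply: mg; apply: measurableU; exact: measurable_itv.
- by move=> u _; rewrite lee_fin.
- apply/disj_setPS => u [] /=; rewrite !in_itv/= => /andP[_ um] /andP[mu _].
  by have := lt_le_trans mu um; rewrite ltxx.
Qed.

End weak_limit.

(** The infimum defining [LSreg tau v x] is approached at some point to the right of [x]; should it
    lie beyond [z], monotonicity allows the midpoint of [x] and [z] instead. *)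
Lemma LSreg_approx (R : realType) (tau : R) (v : R -> R) (x z eta : R) :
  0 < tau -> Vset tau v -> 0 <= x -> x < z -> z <= tau -> 0 < eta ->
  exists y, x < y < z /\ v y <= LSreg tau v x + eta.
Proof.
move=> tau0 Vv x0 xz zt eta0; have xt := lt_le_trans xz zt.
rewrite LSreg_inf//.
have [_ [y /= + <-] yx] := inf_adherent eta0 (LSreg_has_inf Vv x0 xt).
rewrite in_itv/= => /andP[xy yt].
have [yz|zy] := ltP y z; first by exists y; rewrite xy yz ltW.
exists ((x + z) / 2); split; first by lra.
by apply: (le_trans _ (ltW yx)); apply: (VsetP Vv) => //; lra.
Qed.

Lemma exists_step (R : realType) (y : nat -> R) (u : R) m :
  y 0%N < u -> u <= y m -> exists i : 'I_m, y i < u <= y i.+1.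
Proof.
move=> y0u; elim: m => [|m IH] um; first by have := lt_le_trans y0u um; rewrite ltxx.
have [/IH[i yiu]|ymu] := leP u (y m); last by exists ord_max; rewrite /= ymu um.
by exists (widen_ord (leqnSn m) i).
Qed.

Section weak_limit_ge.
Context {R : realType} (tau : R) (tau0 : 0 < tau) (v : R -> R) (Vv : Vset tau v).
Context (U : set_system nat) {PU : ProperFilter U} (s : nat -> seq R).
Hypothesis s_gt0 : forall N, (0 < size (s N))%N.
Hypothesis s_tau : forall N u, u \in s N -> 0 <= u <= tau.
Hypothesis sv : forall x, empirical_cdf (s N) x @[N --> U] --> v x.
Context (g : R -> R) (B mu : R).
Hypothesis gc : continuous g.
Hypothesis gB : forall u, 0 <= g u <= B.
Hypothesis g0 : g 0 = 0.
Hypothesis g_mean : forall e, 0 < e ->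
  \forall N \near U, (mu - e) * (size (s N))%:R <= \sum_(u <- s N) g u.

(** The same step values [c i] bound [g] from below on []x i, x i.+1]], where the limit measure is
    evaluated, and approximate it on []y i, y i.+1]], where sample points are counted: both
    intervals lie within one mesh [h <= d] of [x i.+1]. *)
Lemma weak_limit_ge : (mu%:E <= LSint tau v g)%E.
Proof.
(* The error budget: [e] from [g_mean], [2 * e] from replacing [g] by the step values, [e] from
   passing from [v] to [F]. Four of the five shares are spent. *)
apply/lee_addgt0Pr => e5 e50; pose e := e5 / 5.
have e0 : 0 < e by rewrite divr_gt0.
have B0 : 0 <= B by case/andP: (gB 0); exact: le_trans.
have [d d0 gd] := segment_unif_continuous 0 tau gc e0.
pose m := (Num.truncn (tau / d)).+1.
have m0 : 0 < m%:R :> R by rewrite ltr0n.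
pose h := tau / m%:R.
have h0 : 0 < h by rewrite divr_gt0.
have hd : h <= d.
  by rewrite ler_pdivrMr// mulrC -ler_pdivrMr//; exact/ltW/truncnS_gt.
pose x i := i%:R * h.
have x0 : x 0%N = 0 by rewrite /x mul0r.
have xm : x m = tau by rewrite /x /h mulrC divfK ?gt_eqF.
have xS i : x i.+1 = x i + h by rewrite /x -natr1 mulrDl mul1r.
have xh : {homo x : i j / (i <= j)%N >-> i <= j}.
  by move=> i j ij; rewrite /x ler_pM2r// ler_nat.
have x_ge0 i : 0 <= x i by rewrite -x0 xh.
have x_le i : (i <= m)%N -> x i <= tau by move=> im; rewrite -xm xh.
(* Each of the [m] steps loses at most [B * eta], less than [e] in all; the [+ 1] covers [B = 0]. *)
pose eta := e / (m%:R * B + 1).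
have mB1 : 0 < m%:R * B + 1 by rewrite ltr_wpDl// mulr_ge0// ltW.
have eta0 : 0 < eta by rewrite divr_gt0.
pose F := LSreg tau v.
(* [v] and its right-continuous version [F] may differ at the partition points;
   a nearby [y i > x i] with [v (y i)] close to [F (x i)] replaces [x i] on the
   side of the empirical measures. *)
have /boolp.choice[y yP] : forall i, exists y : R, if (i < m)%N
    then x i < y < x i.+1 /\ v y <= F (x i) + eta else y = tau.
  move=> i; case: (ltnP i m) => im; last by exists tau.
  apply: LSreg_approx => //; last exact: x_le.
  by rewrite xS ltrDl.
have ylt i : (i < m)%N -> x i < y i < x i.+1.
  by move=> im; have := yP i; rewrite im => -[].
have ym : y m = tau by have := yP m; rewrite ltnn.
have ygt0 i : (i < m)%N -> 0 < y i.
  by move=> /ylt/andP[+ _]; exact: le_lt_trans.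
have y_le i : (i < m)%N -> y i <= y i.+1.
  move=> im; case/andP: (ylt i im) => _ /ltW yx; apply: (le_trans yx).
  move: im; rewrite leq_eqVlt => /predU1P[->|im]; first by rewrite ym xm.
  by case/andP: (ylt _ im) => /ltW.
(* The truncation at 0 keeps the weights nonnegative, so that inequalities between increments can be
   multiplied by them; since [g] is nonnegative, [c i] stays below [g] on the step. *)
pose c i := Num.max 0 (g (x i.+1) - e).
have c0 i : 0 <= c i by rewrite le_max lexx.
have cB i : c i <= B.
  rewrite ge_max B0/=; case/andP: (gB (x i.+1)) => _; lra.
have x_dist i : (i < m)%N -> 0 <= x i.+1 <= tau by move=> im; rewrite x_ge0 x_le.
have step : ((\sum_(i < m) c i * (F (x i.+1) - F (x i)))%:E <= LSint tau v g)%E.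
  have [G GF LG] := LSmeasureE tau0 Vv.
  rewrite /LSint LG -/F /F -GF.
  apply: (@le_trans _ _
    (\int[lebesgue_stieltjes_measure G]_(u in `]x 0%N, x m]%classic) (g u)%:E)%E).
    apply: step_sum_le_integral => // [u|i u im xu]; first by case/andP: (gB u).
    rewrite ge_max; case/andP: (gB u) => -> _ /=.
    have : `|g u - g (x i.+1)| <= e.
      apply: gd; first exact: x_dist.
      rewrite ler_norml; move: xu; rewrite xS; lra.
    by rewrite ler_norml; lra.
  apply: ge0_subset_integral.
  - exact: measurable_itv.
  - exact: measurable_itv.
  - apply/measurable_EFinP; apply: measurable_funTS.
    exact: continuous_measurable_fun.
  - by move=> u _; rewrite lee_fin; case/andP: (gB u).
  - rewrite x0 xm; apply: subset_itvr; by rewrite bnd_simp.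
have cv : \sum_(i < m) c i * (empirical_cdf (s N) (y i.+1) - empirical_cdf (s N) (y i))
    @[N --> U] --> \sum_(i < m) c i * (v (y i.+1) - v (y i)).
  apply: cvg_big => [|i _]; first exact: add_continuous. apply: cvgMr.
  by apply: cvgB; exact: sv.
have vmu : mu - 3 * e <= \sum_(i < m) c i * (v (y i.+1) - v (y i)).
  apply: (cvgr_to_ge cv); apply: filterS (g_mean e0) => N sN.
  rewrite (eq_bigr (fun i : 'I_m => (\sum_(u <- s N) c i * ((y i < u) && (u <= y i.+1))%:R)
      / (size (s N))%:R)); last first.
    by move=> i _; rewrite empirical_cdf_increment ?ygt0 ?y_le// mulrA mulr_sumr.
  rewrite -mulr_suml ler_pdivlMr ?ltr0n// exchange_big/=.
  have -> : (mu - 3 * e) * (size (s N))%:R =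
      (mu - e) * (size (s N))%:R - \sum_(u <- s N) (2 * e).
    rewrite big_const_seq count_predT iter_addr addr0 -mulr_natr; lra.
  rewrite lerBlDr (le_trans sN)// -big_split/= big_seq [leRHS]big_seq.
  apply: ler_sum => u us; have /andP[u0 ut] := s_tau us.
  have pos : 0 <= \sum_(i < m) c i * ((y i < u) && (u <= y i.+1))%:R.
    by apply: sumr_ge0 => i _; rewrite mulr_ge0.
  (* Points up to [y 0] belong to no step. They satisfy [u <= h <= d], so [g u <= e] because
     [g 0 = 0]. *)
  have [uy0|y0u] := leP u (y 0%N).
    have : `|g u - g 0| <= e.
      apply: gd; first by rewrite lexx ltW.
      rewrite subr0 ger0_norm//; apply: (le_trans uy0).
      by case/andP: (ylt 0%N isT) => _; rewrite xS x0 => /ltW; lra.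
    by rewrite g0 subr0 ler_norml; lra.
  have [|i yiu] := exists_step y0u (m := m); first by rewrite ym.
  rewrite (bigD1 i)//= yiu mulr1.
  have : 0 <= \sum_(j < m | j != i) c j * ((y j < u) && (u <= y j.+1))%:R.
    by apply: sumr_ge0 => j _; rewrite mulr_ge0.
  have : g (x i.+1) - e <= c i by rewrite le_max lexx orbT.
  have : `|g u - g (x i.+1)| <= e.
    apply: gd; first exact: x_dist.
    have /andP[xyi yxi] := ylt i (ltn_ord i).
    case/andP: yiu => yiu uyi; rewrite ler_norml.
    have : u <= x i.+1 + h.
      have := ltn_ord i; rewrite leq_eqVlt => /predU1P[im|im].
        by rewrite im xm; lra.
      by have /andP[_] := ylt _ im; rewrite xS; lra.
    move: xyi yxi; rewrite xS; lra.
  by rewrite ler_norml; lra.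
have Fv : \sum_(i < m) c i * (v (y i.+1) - v (y i)) - e <=
    \sum_(i < m) c i * (F (x i.+1) - F (x i)).
  rewrite lerBlDr.
  apply: (@le_trans _ _ (\sum_(i < m) (c i * (F (x i.+1) - F (x i)) + B * eta))).
    apply: ler_sum => i _.
    apply: (@le_trans _ _ (c i * (F (x i.+1) - F (x i)) + c i * eta)).
      rewrite -mulrDr ler_wpM2l//.
      have /andP[xyi yxi] := ylt i (ltn_ord i).
      (* Together with the next bound, this shows that the increment of [v] between [y i] and
         [y i.+1] exceeds that of [F] between [x i] and [x i.+1] by at most [eta]. At the last node
         both functions equal [v tau]. *)
      have : F (x i) <= v (y i).
        by apply: LSreg_le => //; rewrite (le_trans (ltW yxi))// x_le.
      have : v (y i.+1) <= F (x i.+1) + eta.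
        have := ltn_ord i; rewrite leq_eqVlt => /predU1P[im|im].
          by rewrite im ym xm /F LSreg_ge_tau// lerDl ltW.
        by have := yP i.+1; rewrite im => -[].
      by lra.
    by rewrite lerD2l ler_wpM2r// ltW.
  rewrite big_split/= lerD2l sumr_const card_ord -mulr_natl mulrA /eta.
  rewrite mulrA ler_pdivrMr// [leRHS]mulrC ler_wpM2r ?ltW//.
  by rewrite ltrDl.
apply: le_trans (leeD step (lexx _)).
by rewrite -EFinD lee_fin; rewrite /e in vmu Fv *; lra.
Qed.

End weak_limit_ge.

(** Stage [N] handles the first [N + 1] functions with slack [1 / (N + 1)]. A fixed [g k] takes part
    from stage [k] on and the slack vanishes, so in the limit every constraint holds at level
    [mu]. *)
Lemma optimal_distribution (R : realType) (tau : R) (g : nat -> R -> R) (B mu : R) :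
  0 < tau -> (forall k, continuous (g k)) ->
  (forall k u, 0 <= g k u <= B) -> (forall k, g k 0 = 0) ->
  (forall mu' K (a : 'I_K -> R), mu' < mu -> (forall k, 0 <= a k) ->
    exists2 u, 0 <= u <= tau & mu' * \sum_k a k <= \sum_k a k * g k u) ->
  exists v, [/\ Vset tau v, v 0 = 0, v tau = 1 &
    forall k, (mu%:E <= LSint tau v (g k))%E].
Proof.
move=> tau0 gc gB g0 H.
have /boolp.choice[s sP] : forall N, exists s : seq R, [/\ (0 < size s)%N,
    forall u, u \in s -> 0 <= u <= tau &
    forall k : 'I_N.+1, (mu - N.+1%:R^-1) * (size s)%:R <= \sum_(u <- s) g k u].
  (* One half of the slack puts the level strictly below [mu], where the hypothesis applies; the
     other half is the error of [approximate_minimax]. *)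
  move=> N; pose e : R := N.+1%:R^-1 / 2.
  have e0 : 0 < e by rewrite divr_gt0 ?invr_gt0 ?ltr0n.
  have [||s [s0 st sg]] := @approximate_minimax R R (fun u => 0 <= u <= tau) N.+1
      (fun k u => g k u) (mu - e) ((`|mu - e| + B) ^+ 2) e _ _ e0.
  - move=> k u _; rewrite -[leLHS]real_normK ?num_real//.
    have /andP[gu0 guB] := gB k u.
    rewrite ler_sqr ?nnegrE//; last by rewrite addr_ge0// (le_trans gu0).
    by rewrite (le_trans (ler_normB _ _))// lerD2l ger0_norm.
  - by move=> a a0; apply: H => //; rewrite ltrBlDr ltrDl.
  exists s; split => // k; apply: le_trans (sg k); rewrite ler_pM2r ?ltr0n//.
  by rewrite -addrA -opprD -splitr.
have [U [v [PU ooU sv]]] := bounded_filter_limits (fun N => empirical_cdf01 (s N)).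
have v0 : v 0 = 0.
  apply: (cvg_unique _ (sv 0)) => //.
  rewrite (_ : (fun N => _) = fun=> 0); first exact: cvg_cst.
  by apply/funext => N; rewrite /empirical_cdf lexx.
have vt : v tau = 1.
  apply: (cvg_unique _ (sv tau)) => //.
  rewrite (_ : (fun N => _) = fun=> 1); first exact: cvg_cst.
  apply/funext => N; rewrite /empirical_cdf leNgt tau0/=.
  have [s0 st _] := sP N.
  have /eqP -> : count (fun u => u <= tau) (s N) == size (s N).
    by rewrite -all_count; apply/allP => u /st /andP[].
  by rewrite divff// pnatr_eq0 -lt0n.
have vh x y : x <= y -> v x <= v y.
  move=> xy; rewrite -subr_ge0; apply: (cvgr_to_ge (cvgB (sv y) (sv x))).
  by apply: filterE => N; rewrite /= subr_ge0 empirical_cdf_homo.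
have Vv : Vset tau v.
  split; first by move=> x y _ _; exact: vh.
  split.
    exists 1 => x _; rewrite ger0_norm; last first.
      by apply: (cvgr_to_ge (sv x)); apply: filterE => N; case/andP: (empirical_cdf01 (s N) x).
    by apply: (cvgr_to_le (sv x)); apply: filterE => N; case/andP: (empirical_cdf01 (s N) x).
  exists 0, tau; rewrite !in_itv/= !lexx ltW// v0 vt; split => //; split => //.
  by rewrite eq_sym oner_eq0.
exists v; split => // k.
apply: (@weak_limit_ge _ _ tau0 _ Vv U _ s _ _ sv _ B) => //.
- by move=> N; have [] := sP N.
- by move=> N u; have [_ + _] := sP N; apply.
- move=> e e0; apply: ooU; near=> N.
  have kN : (k < N.+1)%N by rewrite ltnS; near: N; exact: nbhs_infty_ge.
  have [s0 _ /(_ (Ordinal kN))/=] := sP N.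
  apply: le_trans; rewrite ler_pM2r ?ltr0n// lerD2l lerN2.
  rewrite invf_ple ?posrE ?ltr0n// ltW// (lt_le_trans (truncnS_gt _))// ler_nat ltnS.
  by near: N; exact: nbhs_infty_ge.
Unshelve. all: by end_near. Qed.

(** * Fourier coefficients *)

Section fourier.
Context {R : realType}.
Implicit Types (f g : R -> R[i]) (k : int).
Local Open Scope complex_scope.
Local Notation D := (`[0, 2 * pi]%classic : set R).
Local Notation mu := (@lebesgue_measure R).

Let cint f := mu.-integrable D (fun x => (complex.Re (f x))%:E) /\
              mu.-integrable D (fun x => (complex.Im (f x))%:E).

Let mD : measurable D. Proof. exact: measurable_itv. Qed.
#[local] Hint Resolve mD : core.

Lemma continuous_integrable02pi (h : R -> R) : continuous h ->
  mu.-integrable D (EFin \o h).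
Proof.
move=> hc; apply: continuous_compact_integrable; first exact: segment_compact.
exact: continuous_subspaceT.
Qed.

Lemma cint02piD f g : cint f -> cint g ->
  cint (fun x => f x + g x) /\
  cint02pi (fun x => f x + g x) = cint02pi f + cint02pi g.
Proof.
move=> [fr fi] [gr gi].
have E (c : R[i] -> R) : {morph c : x y / x + y} ->
    mu.-integrable D (fun x => (c (f x))%:E) ->
    mu.-integrable D (fun x => (c (g x))%:E) ->
    mu.-integrable D (fun x => (c (f x + g x))%:E) /\
    Rintegral mu D (fun x => c (f x + g x)) =
      Rintegral mu D (fun x => c (f x)) + Rintegral mu D (fun x => c (g x)).
  move=> cD cf cg; split; last first.
    by rewrite -RintegralD//; apply: eq_Rintegral => x _; rewrite cD.
  rewrite (_ : (fun x => _) = ((fun x => (c (f x))%:E) \+ (fun x => (c (g x))%:E))%E).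
    exact: integrableD.
  by apply/funext => x /=; rewrite cD.
have ReD : {morph @complex.Re R : x y / x + y} by case=> ? ? [].
have ImD : {morph @complex.Im R : x y / x + y} by case=> ? ? [].
have [ri rE] := E _ ReD fr gr.
have [ii iE] := E _ ImD fi gi.
by split=> //; rewrite /cint02pi rE iE.
Qed.

Lemma cint02pi_mull (h : R -> R[i]) f : 
  continuous (fun x => complex.Re (h x)) -> continuous (fun x => complex.Im (h x)) ->
  cint f -> cint (fun x => h x * f x).
Proof.
move=> hr hi [fr fi].
have E (u : R -> R) (w : R -> R) : continuous u -> mu.-integrable D (fun x => (w x)%:E) ->
    mu.-integrable D (fun x => (u x * w x)%:E).
  move=> uc wi.
  rewrite (_ : (fun x => _) = ((EFin \o u) \* (fun x => (w x)%:E))%E)//.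
  apply: integrableMr => //.
    by apply: measurable_funTS; exact: continuous_measurable_fun.
  have : compact (u @` D).
    by apply: continuous_compact; [exact: continuous_subspaceT|exact: segment_compact].
  move=> /compact_bounded [M [Mr MB]]; exists M; split => // N MN x Dx.
  by apply: MB => //; exists x.
have hE x : h x * f x = Complex
    (complex.Re (h x) * complex.Re (f x) - complex.Im (h x) * complex.Im (f x))
    (complex.Re (h x) * complex.Im (f x) + complex.Im (h x) * complex.Re (f x)).
  by case: (h x) => a b; case: (f x).
split.
  rewrite (_ : (fun x => _) = ((fun x => (complex.Re (h x) * complex.Re (f x))%:E) \-
    (fun x => (complex.Im (h x) * complex.Im (f x))%:E))%E).
    by apply: integrableB => //; exact: E.
  by apply/funext => x; rewrite hE.
rewrite (_ : (fun x => _) = ((fun x => (complex.Re (h x) * complex.Im (f x))%:E) \+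
    (fun x => (complex.Im (h x) * complex.Re (f x))%:E))%E).
  by apply: integrableD => //; exact: E.
by apply/funext => x; rewrite hE.
Qed.

Lemma cint02piZ (c : R[i]) f : cint f ->
  cint02pi (fun x => c * f x) = c * cint02pi f.
Proof.
case: c => a b [fr fi]; rewrite /cint02pi.
have E (u : R) (w : R -> R) : mu.-integrable D (fun x => (w x)%:E) ->
   mu.-integrable D (fun x => (u * w x)%:E).
  by move=> wi; rewrite (_ : (fun x => _) = (fun x => u%:E * (w x)%:E)%E)//; exact: integrableZl.
have -> : (fun x => complex.Re (Complex a b * f x)) =
    (fun x => a * complex.Re (f x) - b * complex.Im (f x)).
  by apply/funext => x; case: (f x).
have -> : (fun x => complex.Im (Complex a b * f x)) =
    (fun x => a * complex.Im (f x) + b * complex.Re (f x)).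
  by apply/funext => x; case: (f x).
rewrite RintegralB//; [|exact: E..]; rewrite RintegralD//; [|exact: E..].
by rewrite !RintegralZl.
Qed.

Lemma trig_int_period k : cos (k%:~R * (2 * pi)) = 1 :> R /\ sin (k%:~R * (2 * pi)) = 0 :> R.
Proof.
have H (m : nat) : cos (m%:R * (2 * pi)) = 1 :> R /\ sin (m%:R * (2 * pi)) = 0 :> R.
  have -> : m%:R * (2 * pi) = 0 + pi *+ 2 *+ m :> R.
    by rewrite add0r -[pi *+ 2 *+ m]mulr_natl -[pi *+ 2]mulr_natl.
  by rewrite (periodicn (@cosD2pi R)) (periodicn (@sinD2pi R)) cos0 sin0.
case: k => m; first exact: H.
by rewrite NegzE mulrNz mulNr cosN sinN; case: (H m.+1) => -> ->; rewrite oppr0.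
Qed.

Lemma continuous_mull_comp (h : R -> R) (a : R) : continuous h ->
  continuous (fun x => h (a * x)).
Proof.
move=> hc x; apply: (@continuous_comp _ _ _ (fun x => a * x) h); last exact: hc.
exact: mulrl_continuous.
Qed.

Lemma integral_derive02pi (h H : R -> R) : continuous h ->
  (forall x : R, is_derive x (1 : R) H (h x)) ->
  Rintegral mu D h = H (2 * pi) - H 0.
Proof.
move=> hc dH; have pi20 : 0 < 2 * pi :> R by rewrite mulr_gt0// pi_gt0.
have Hc : continuous H.
  by move=> x; apply/differentiable_continuous/derivable1_diffP; exact: ex_derive.
rewrite /Rintegral (continuous_FTC2 (F := H) pi20)//.
- exact: continuous_subspaceT.
- split; first by move=> x _; exact: ex_derive.
  + exact/cvg_at_right_filter/Hc.
  + exact/cvg_at_left_filter/Hc.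
- by move=> x _; rewrite derive1E; exact: derive_val.
Qed.

Lemma cint02pi_expi k :
  cint02pi (fun x => expi (k%:~R * x)) = (if k == 0 then (2 * pi)%:C else 0 : R[i]).
Proof.
rewrite /cint02pi /expi/=; case: eqVneq => [->|k0].
  transitivity (Complex (Rintegral mu D (cst 1)) (Rintegral mu D (cst 0))).
    by congr Complex; apply: eq_Rintegral => x _; rewrite mul0r ?cos0 ?sin0.
  rewrite (@integral_derive02pi (cst 1) id) ?(@integral_derive02pi (cst 0) (cst 0))//.
  - by rewrite subr0 subrr.
  - by move=> x; exact: cst_continuous.
  - by move=> x; exact: cst_continuous.
have kR : k%:~R != 0 :> R by rewrite intr_eq0.
have [ck sk] := trig_int_period k.
have dsin (x : R) : is_derive x (1 : R) (fun y : R => k%:~R^-1 * sin (k%:~R * y))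
    (cos (k%:~R * x)).
  by apply: is_derive_eq; rewrite /GRing.scale/=; field.
have dcos (x : R) : is_derive x (1 : R) (fun y : R => - (k%:~R^-1 * cos (k%:~R * y)))
    (sin (k%:~R * x)).
  by apply: is_derive_eq; rewrite /GRing.scale/=; field.
rewrite (integral_derive02pi (continuous_mull_comp (@continuous_cos R)) dsin).
rewrite (integral_derive02pi (continuous_mull_comp (@continuous_sin R)) dcos).
by rewrite ck sk !mulr0 sin0 cos0 mulr0 !subrr.
Qed.

Lemma expiD (a b : R) : expi (a + b) = expi a * expi b.
Proof. by rewrite /expi cosD sinD; congr Complex; rewrite addrC mulrC [X in _ + X]mulrC. Qed.

Lemma continuous_Re_expi k : continuous (fun x : R => complex.Re (expi (k%:~R * x))).
Proof. exact: (continuous_mull_comp (@continuous_cos R)). Qed.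

Lemma continuous_Im_expi k : continuous (fun x : R => complex.Im (expi (k%:~R * x))).
Proof. exact: (continuous_mull_comp (@continuous_sin R)). Qed.

Lemma cint_expi k : cint (fun x => expi (k%:~R * x)).
Proof.
by split; apply: continuous_integrable02pi;
  [exact: continuous_Re_expi|exact: continuous_Im_expi].
Qed.

Lemma cintZ (c : R[i]) f : cint f -> cint (fun x => c * f x).
Proof. by apply: cint02pi_mull => x; exact: cst_continuous. Qed.

Lemma fcoefE f k :
  fcoef f k = ((2 * pi)^-1)%:C * cint02pi (fun x => expi ((- k)%:~R * x) * f x).
Proof.
rewrite /fcoef; congr (_ * cint02pi _); apply/funext => x.
by rewrite mulrC mulrNz mulNr.
Qed.

Lemma cint_mul_expi f k : cint f -> cint (fun x => expi (k%:~R * x) * f x).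
Proof.
by apply: cint02pi_mull; [exact: continuous_Re_expi|exact: continuous_Im_expi].
Qed.

Lemma fcoefD f g k : cint f -> cint g ->
  fcoef (fun x => f x + g x) k = fcoef f k + fcoef g k.
Proof.
move=> cf cg; rewrite !fcoefE -mulrDr; congr (_ * _).
rewrite -(cint02piD (cint_mul_expi (- k) cf) (cint_mul_expi (- k) cg)).2.
by congr cint02pi; apply/funext => x; rewrite mulrDr.
Qed.

Lemma fcoefZ (c : R[i]) f k : cint f -> fcoef (fun x => c * f x) k = c * fcoef f k.
Proof.
move=> cf; rewrite !fcoefE mulrCA -(cint02piZ c (cint_mul_expi (- k) cf)).
by congr (_ * cint02pi _); apply/funext => x; rewrite mulrCA.
Qed.

Lemma fcoef_expi j k : fcoef (fun x : R => expi (j%:~R * x)) k = (j == k)%:R.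
Proof.
rewrite fcoefE.
have -> : (fun x : R => expi ((- k)%:~R * x) * expi (j%:~R * x)) =
    (fun x : R => expi ((j - k)%:~R * x)).
  by apply/funext => x; rewrite -expiD -mulrDl -intrD [- k + j]addrC.
rewrite cint02pi_expi subr_eq0; case: eqVneq => _; last by rewrite mulr0.
by rewrite -rmorphM mulVf// mulf_neq0 ?pnatr_eq0// gt_eqF// pi_gt0.
Qed.

Lemma eq_fcoef f g k : f =1 g -> fcoef f k = fcoef g k.
Proof. by move=> /funext ->. Qed.

Lemma fcoef0 k : fcoef (fun=> 0 : R[i]) k = 0.
Proof.
rewrite (_ : (fun=> 0) = (fun x : R => 0 * expi (0%:~R * x))).
  by rewrite fcoefZ; [rewrite mul0r|exact: cint_expi].
by apply/funext => x; rewrite mul0r.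
Qed.

Lemma cint_sum (I : Type) (r : seq I) (F : I -> R -> R[i]) :
  (forall i, cint (F i)) -> cint (fun x => \sum_(i <- r) F i x).
Proof.
move=> cF; elim: r => [|i r IH].
  rewrite (_ : (fun x => _) = (fun x : R => 0 * expi (0%:~R * x))).
    by apply: cintZ; exact: cint_expi.
  by apply/funext => x; rewrite big_nil mul0r.
rewrite (_ : (fun x => _) = (fun x => F i x + \sum_(j <- r) F j x)).
  exact: (cint02piD (cF i) IH).1.
by apply/funext => x; rewrite big_cons.
Qed.

Lemma fcoef_sum (I : Type) (r : seq I) (F : I -> R -> R[i]) k :
  (forall i, cint (F i)) ->
  fcoef (fun x => \sum_(i <- r) F i x) k = \sum_(i <- r) fcoef (F i) k.
Proof.
move=> cF; elim: r => [|i r IH].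
  rewrite big_nil -[RHS](fcoef0 k).
  by apply: eq_fcoef => x; rewrite big_nil.
rewrite big_cons -IH -fcoefD//; last exact: cint_sum.
by apply: eq_fcoef => x; rewrite big_cons.
Qed.

Lemma Lper_cint f : Lper f -> cint f.
Proof. by case=> _. Qed.

Lemma expi_periodic k (x : R) : expi (k%:~R * (x + 2 * pi)) = expi (k%:~R * x).
Proof.
rewrite mulrDr expiD /expi; have [-> ->] := trig_int_period k.
exact: mulr1.
Qed.

(** The free index type and frequency map [e] let one computation serve the members of [trigpoly],
    the test polynomials and the constants. *)
Definition trig_sum (I : Type) (r : seq I) (c : I -> R[i]) (e : I -> int) : R -> R[i] :=
  fun x => \sum_(i <- r) c i * expi ((e i)%:~R * x).

Lemma cint_trig_sum (I : Type) (r : seq I) (c : I -> R[i]) (e : I -> int) :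
  cint (trig_sum r c e).
Proof. by apply: cint_sum => i; apply: cintZ; exact: cint_expi. Qed.

Lemma Lper_trig_sum (I : Type) (r : seq I) (c : I -> R[i]) (e : I -> int) :
  Lper (trig_sum r c e).
Proof.
split; last exact: cint_trig_sum.
by move=> x; apply: eq_bigr => i _; rewrite expi_periodic.
Qed.

Lemma fcoef_trig_sum (I : Type) (r : seq I) (c : I -> R[i]) (e : I -> int) k :
  fcoef (trig_sum r c e) k = \sum_(i <- r) c i * (e i == k)%:R.
Proof.
rewrite fcoef_sum; last by move=> i; apply: cintZ; exact: cint_expi.
by apply: eq_bigr => i _; rewrite fcoefZ ?fcoef_expi//; exact: cint_expi.
Qed.

Lemma fcoef_sub_trig_sum f (I : Type) (r : seq I) (c : I -> R[i]) (e : I -> int) k :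
  Lper f -> fcoef (fun x => f x - trig_sum r c e x) k =
            fcoef f k - \sum_(i <- r) c i * (e i == k)%:R.
Proof.
move=> /Lper_cint cf; have ct := cint_trig_sum r c e.
rewrite -fcoef_trig_sum -mulN1r -fcoefZ// -fcoefD//; last exact: cintZ.
by apply: eq_fcoef => x; rewrite mulN1r.
Qed.

Lemma sum_frequencies (c : int -> R[i]) (m : nat) k :
  \sum_(j < (2 * m).+1) c (j%:Z - m%:Z) * ((j%:Z - m%:Z) == k)%:R =
  if (`|k| <= m)%N then c k else 0.
Proof.
case: ifPn => km.
  have jm : (absz (k + m%:Z)%R < (2 * m).+1)%N by lia.
  rewrite (bigD1 (Ordinal jm))//= big1 ?addr0 => [|j].
    have -> : Posz (absz (k + m%:Z)%R) - m%:Z = k by lia.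
    by rewrite eqxx mulr1.
  rewrite -val_eqE/= => jk; case: eqVneq => [|_]; last by rewrite mulr0.
  by move=> E; move: jk; rewrite -E; lia.
rewrite big1// => j _; case: eqVneq => [E|_]; last by rewrite mulr0.
by move: km; rewrite -E; have := ltn_ord j; lia.
Qed.

Lemma fcoef_sub_trigpoly f (c : int -> R[i]) (m : nat) k : Lper f ->
  fcoef (fun x => f x - \sum_(j < (2 * m).+1)
                    c (j%:Z - m%:Z) * expi ((j%:Z - m%:Z)%:~R * x)) k =
  if (`|k| <= m)%N then fcoef f k - c k else fcoef f k.
Proof.
move=> Lf; rewrite fcoef_sub_trig_sum// sum_frequencies.
by case: ifP => //; rewrite subr0.
Qed.

(** Turns the almost-everywhere constancy in [nonconst] into information on coefficients. *)
Lemma fcoef_ae_eq0 f k : cint f ->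
  {ae mu, forall x, x \in `[0, 2 * pi] -> f x = 0} -> fcoef f k = 0.
Proof.
move=> cf f0; rewrite fcoefE.
have [gr gi] := cint_mul_expi (- k) cf.
have E (c : R[i] -> R) : c 0 = 0 ->
    mu.-integrable D (fun x => (c (expi ((- k)%:~R * x) * f x))%:E) ->
    Rintegral mu D (fun x => c (expi ((- k)%:~R * x) * f x)) = 0.
  move=> c0 ci; rewrite /Rintegral (@ae_eq_integral _ _ _ mu D (cst 0%E))//.
  - by rewrite integral0.
  - exact: measurable_int ci.
  - apply: negligibleS f0 => x /= nE fx0; apply: nE => Dx.
    by rewrite fx0// mulr0 c0.
by rewrite /cint02pi !E// mulr0.
Qed.

End fourier.

(** * Upper bound *)

Lemma continuous_powR_comp (R : realType) (h : R -> R) (p : R) : 0 < p ->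
  continuous h -> (forall x, 0 <= h x) -> continuous (fun x => h x `^ p).
Proof.
move=> p0 hc h0 x; have := h0 x; rewrite le_eqVlt => /predU1P[hx|hx].
  apply/cvgrPdist_le => e e0; rewrite -hx powR0 ?gt_eqF//.
  have ep : 0 < e `^ p^-1 by rewrite powR_gt0.
  have /cvgrPdist_lt/(_ _ ep) := hc x; apply: filterS => y.
  rewrite -hx !sub0r !normrN !ger0_norm ?powR_ge0// => /ltW hy.
  rewrite (_ : e = (e `^ p^-1) `^ p); last first.
    by rewrite -powRrM mulVf ?gt_eqF// powRr1// ltW.
  by apply: ge0_ler_powR; rewrite ?nnegrE ?powR_ge0// ltW.
apply: (@continuous_comp _ _ _ h (fun y => y `^ p)); first exact: hc.
apply/differentiable_continuous/derivable1_diffP; apply: derivable_powR.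
by rewrite in_itv/= hx.
Qed.

Section poweR_root.
Context {R : realType} (p : R) (p0 : 0 < p).
Implicit Types x y : \bar R.
Local Open Scope ereal_scope.

Lemma poweR_rootK x : 0 <= x -> poweR (poweR x p^-1) p = x.
Proof. by move=> x0; rewrite -poweRrM mulVf ?gt_eqF// poweRe1. Qed.

Lemma poweRK_root x : 0 <= x -> poweR (poweR x p) p^-1 = x.
Proof. by move=> x0; rewrite -poweRrM mulfV ?gt_eqF// poweRe1. Qed.

Lemma le_poweR (r : R) x y : (0 <= r)%R -> 0 <= x -> x <= y -> poweR x r <= poweR y r.
Proof.
move=> r0 x0 xy; apply: gt0_ler_poweR => //; rewrite in_itv/= ?x0 ?leey//.
by rewrite (le_trans x0).
Qed.

End poweR_root.

Lemma sum_le_esum (R : realType) (T : choiceType) (a : T -> \bar R) (S : set T) (r : seq T) :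
  uniq r -> (forall k, k \in r -> S k) -> (\sum_(k <- r) a k <= \esum_(k in S) a k)%E.
Proof.
move=> ur rS; apply: esum_ge; exists [set` r]; last by rewrite fsbig_seq.
by split; [exact: finite_seq|exact: rS].
Qed.

Lemma esum_le (R : realType) (T : choiceType) (a : T -> \bar R) (S : set T) (M : \bar R) :
  (forall r : seq T, uniq r -> (forall k, k \in r -> S k) -> (\sum_(k <- r) a k <= M)%E) ->
  (\esum_(k in S) a k <= M)%E.
Proof.
move=> H; apply: ge_ereal_sup => _ [F [finF FS] <-].
rewrite fsbig_finite//; apply: H; first exact: finmap.fset_uniq.
by move=> k; rewrite in_fset_set// inE => /FS.
Qed.

(** * Best approximation as a tail of the coefficient sum *)

Section Sp_theory.
Context {R : realType} (p : R) (p0 : 0 < p).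
Implicit Types (f : R -> R[i]) (c : int -> R[i]) (A : seq int).
Local Open Scope complex_scope.

Lemma cabs_ge0 (z : R[i]) : 0 <= cabs z.
Proof. by case: z => a b; exact: sqrtr_ge0. Qed.

Lemma cabsMreal (a : R) (z : R[i]) : 0 <= a -> cabs (a%:C * z) = a * cabs z.
Proof.
move=> a0; rewrite /cabs ComplexField.Normc.normcM /=.
by rewrite expr0n/= addr0 sqrtr_sqr ger0_norm.
Qed.

Lemma lpsum_ge0 c (S : set int) : (0 <= \esum_(k in S) (cabs (c k) `^ p)%:E)%E.
Proof. by apply: esum_ge0 => k _; rewrite lee_fin powR_ge0. Qed.

Lemma lpnormK c : poweR (lpnorm p c) p = \esum_(k in [set: int]) (cabs (c k) `^ p)%:E.
Proof. by rewrite poweR_rootK// lpsum_ge0. Qed.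

Lemma lpnorm_ge0 c : (0 <= lpnorm p c)%E.
Proof. exact: poweR_ge0. Qed.

Lemma En_ge0 n f : (0 <= En n p f)%E.
Proof. by apply: le_ereal_inf_tmp => _ [t _ <-]; exact: lpnorm_ge0. Qed.

(** A competitor of degree at most [n.-1] cannot change coefficients with [n <= |k|]. Finite [A]
    suits the test polynomials, whose spectrum is finite. *)
Lemma En_ge n f A : (0 < n)%N -> Lper f -> uniq A ->
  (forall k, k \in A -> (n <= `|k|)%N) ->
  (poweR (\sum_(k <- A) (cabs (fcoef f k) `^ p)%:E) p^-1 <= En n p f)%E.
Proof.
move=> n0 Lf uA nA; apply: le_ereal_inf_tmp => _ [_ [c ->] <-].
apply: le_poweR; first by rewrite invr_ge0 ltW.
  by apply: sume_ge0 => k _; rewrite lee_fin powR_ge0.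
rewrite big_seq.
under eq_bigr => k kA.
  have <- : fcoef (fun x => f x - \sum_(j < (2 * n.-1).+1)
       c (j%:Z - n.-1%:Z) * expi ((j%:Z - n.-1%:Z)%:~R * x)) k = fcoef f k.
    by rewrite fcoef_sub_trigpoly// ifN//; have := nA _ kA; lia.
  over.
by rewrite -big_seq; apply: sum_le_esum.
Qed.

(** The competitor is the partial Fourier sum, which removes every coefficient below [n] and no
    other. *)
Lemma En_le n f : (0 < n)%N -> Lper f ->
  (En n p f <=
   poweR (\esum_(k in [set k : int | (n <= `|k|)%N]) (cabs (fcoef f k) `^ p)%:E) p^-1)%E.
Proof.
move=> n0 Lf.
pose t x := \sum_(j < (2 * n.-1).+1)
       fcoef f (j%:Z - n.-1%:Z) * expi ((j%:Z - n.-1%:Z)%:~R * x).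
apply: (@le_trans _ _ (Spnorm p (fun x => f x - t x))).
  by apply: ereal_inf_lbound; exists t => //; exists (fcoef f).
apply: le_poweR; [by rewrite invr_ge0 ltW|exact: lpsum_ge0|].
rewrite [leRHS]esum_mkcond; apply: le_esum => k _.
rewrite fcoef_sub_trigpoly//; case: ifPn => kn.
  rewrite subrr /cabs ComplexField.Normc.normc0 powR0 ?gt_eqF//.
  by case: ifP; rewrite ?lee_fin// ?powR_ge0.
by rewrite ifT// inE /=; lia.
Qed.

End Sp_theory.

Section upper_bound.
Context {R : realType} (p : R) (p1 : 1 <= p) (tau : R) (tau0 : 0 < tau).
Context (n : nat) (n0 : (0 < n)%N) (phi : R -> R) (hphi : Phi phi).
Implicit Types (f : R -> R[i]) (v : R -> R) (k : int).

Let p0 : 0 < p. Proof. exact: lt_le_trans p1. Qed.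
Let nR0 : 0 < n%:R :> R. Proof. by rewrite ltr0n. Qed.
Let phi_ge0 t : 0 <= phi t. Proof. by case: hphi => _ [_ [+ _]]. Qed.
Let phiN t : phi (- t) = phi t. Proof. by case: hphi => _ [_ [_ [+ _]]]. Qed.
Let phi0 : phi 0 = 0. Proof. by case: hphi => _ [_ [_ [_ [+ _]]]]. Qed.

Definition kernel_fun (k : nat) (u : R) : R := phi (k%:R * u / n%:R) `^ p.

Lemma kernel_fun_ge0 (k : nat) u : 0 <= kernel_fun k u. Proof. exact: powR_ge0. Qed.

Lemma kernel_fun0 (k : nat) : kernel_fun k 0 = 0.
Proof. by rewrite /kernel_fun mulr0 mul0r phi0 powR0// gt_eqF. Qed.

Lemma kernel_fun_continuous (k : nat) : continuous (kernel_fun k).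
Proof.
apply: continuous_powR_comp => //.
rewrite (_ : (fun u => _) = (fun u => phi (k%:R / n%:R * u))).
  by apply: continuous_mull_comp; case: hphi.
by apply/funext => u; rewrite mulrAC.
Qed.

Lemma kernel_fun_bounded : exists2 B, 0 < B & forall (k : nat) u, kernel_fun k u <= B.
Proof.
have [_ [[M phiM] _]] := hphi.
have M0 : 0 <= M by exact: le_trans (phi_ge0 0) (phiM 0).
(* The [+ 1] gives a positive bound without a proof that [M > 0]; [Kconst_gt0] divides by it. *)
exists ((M + 1) `^ p); first by rewrite powR_gt0// ltr_wpDl.
move=> k u; apply: ge0_ler_powR; rewrite ?nnegrE ?addr_ge0//; first exact: ltW.
by rewrite (le_trans (phiM _))// lerDl.
Qed.

Lemma cabs_Delta f k h : cabs (Delta phi h f k) `^ p =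
  phi (k%:~R * h) `^ p * cabs (fcoef f k) `^ p.
Proof. by rewrite /Delta cabsMreal// powRM// cabs_ge0. Qed.

(** Evenness of [phi] and the substitution [u = n |h|], which maps [|h| <= tau / n] onto [[0, tau]],
    connect [omega] with the kernels integrated in [Inphi]. *)
Lemma phi_kernel_fun k h : phi (k%:~R * h) `^ p = kernel_fun `|k|%N (n%:R * `|h|).
Proof.
rewrite /kernel_fun mulrCA mulrAC mulfV ?gt_eqF// mul1r.
have -> : `|k|%N%:R * `|h| = `|k%:~R * h| :> R.
  by rewrite normrM -intr_norm natr_absz.
by congr (_ `^ _); case: (ler0P (k%:~R * h)) => // _; rewrite phiN.
Qed.

Lemma omega_ge0 f d : 0 <= d -> (0 <= omega phi p f d)%E.
Proof.
move=> d0; apply: (@le_trans _ _ (lpnorm p (Delta phi 0 f))).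
  exact: lpnorm_ge0.
by apply: ereal_sup_ubound; exists 0 => //=; rewrite normr0.
Qed.

Lemma omega_lty f d : Sp p f -> (omega phi p f d < +oo)%E.
Proof.
move=> [Lf fS]; have [B B0 kB] := kernel_fun_bounded.
set S := (\esum_(k in _) _)%E in fS.
have S0 : (0 <= S)%E by exact: lpsum_ge0.
have : (poweR (B%:E * S) p^-1 < +oo)%E.
  by apply: poweR_lty; rewrite lte_mul_pinfty// ?lee_fin ltW.
apply: le_lt_trans; apply: ge_ereal_sup => _ [h _ <-].
apply: le_poweR; [by rewrite invr_ge0 ltW|exact: lpsum_ge0|].
apply: esum_le => r ur _.
apply: (@le_trans _ _ (\sum_(k <- r) B%:E * (cabs (fcoef f k) `^ p)%:E)%E).
  apply: lee_sum => k _; rewrite cabs_Delta phi_kernel_fun -EFinM lee_fin.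
  by rewrite ler_wpM2r// powR_ge0.
rewrite -ge0_sume_distrr => [|k _]; last by rewrite lee_fin powR_ge0.
rewrite lee_wpmul2l ?lee_fin ?(ltW B0)//; exact: sum_le_esum.
Qed.

Lemma Delta_le_omega f d h : `|h| <= d ->
  (\esum_(k in [set: int]) (phi (k%:~R * h) `^ p * cabs (fcoef f k) `^ p)%:E <=
   poweR (omega phi p f d) p)%E.
Proof.
move=> hd; rewrite (_ : (\esum_(k in _) _)%E =
    \esum_(k in [set: int]) (cabs (Delta phi h f k) `^ p)%:E); last first.
  by apply: eq_esum => k _; rewrite cabs_Delta.
rewrite -lpnormK//; apply: le_poweR; [exact: ltW|exact: lpnorm_ge0|].
by apply: ereal_sup_ubound; exists h.
Qed.

(** Otherwise [phi (k h) = 0] for all [|h| <= d], and the negligible zero set of [phi] would contain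
    an interval of positive length. *)
Lemma omega_eq0 f d k : 0 < d -> omega phi p f d = 0%E -> k != 0 ->
  cabs (fcoef f k) = 0.
Proof.
move=> d0 w0 k0.
have kR0 : 0 < `|k%:~R| :> R by rewrite normr_gt0 intr_eq0.
have [h hd ph0] : exists2 h, `|h| <= d & phi (k%:~R * h) != 0.
  apply: contrapT => H.
  have [_ [_ [_ [_ [_ neg]]]]] := hphi.
  have : lebesgue_measure.-negligible `[0, `|k%:~R| * d]%classic.
    apply: negligibleS neg => u /=; rewrite in_itv/= => /andP[u0 ud].
    apply: contrapT => pu; apply: H; exists (u / k%:~R).
      by rewrite normrM normfV ler_pdivrMr// mulrC ger0_norm.
    by rewrite mulrCA mulfV ?intr_eq0// mulr1; exact/eqP.
  move=> /(negligibleP lebesgue_measure (measurable_itv `[0, `|k%:~R| * d])) N.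
  have : lebesgue_measure (`[0, `|k%:~R| * d]%classic : set R) = 0%E by exact: N.
  rewrite lebesgue_measure_itv/= lte_fin mulr_gt0// sube0 => /eqP.
  by rewrite eqe mulf_eq0 !gt_eqF.
have := Delta_le_omega f hd; rewrite w0 poweR0r ?gt_eqF//.
have /(_ [:: k] isT (fun _ _ => I)) := @sum_le_esum R int
  (fun k => (phi (k%:~R * h) `^ p * cabs (fcoef f k) `^ p)%:E) [set: int].
rewrite big_seq1 => /le_trans/[apply]; rewrite lee_fin => H.
have : phi (k%:~R * h) `^ p * cabs (fcoef f k) `^ p == 0.
  by rewrite eq_le H mulr_ge0// powR_ge0.
by rewrite mulf_eq0 !powR_eq0 (negbTE ph0)/= => /andP[/eqP].
Qed.

Lemma measurable_kernel_fun (k : nat) (D : set R) : measurable_fun D (EFin \o kernel_fun k).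
Proof.
apply/measurable_EFinP; apply: measurable_funTS.
by apply: continuous_measurable_fun; exact: kernel_fun_continuous.
Qed.

Lemma LSint_cst_le v (g : R -> R) (M : R) : Vset tau v -> continuous g ->
  (forall u, 0 <= g u) -> (forall u, 0 <= u <= tau -> g u <= M) ->
  (LSint tau v g <= M%:E * (v tau - v 0)%:E)%E.
Proof.
move=> Vv gc g0 gM; rewrite -(LSmeasure_itv tau0 Vv) /LSint.
have [F _ ->] := LSmeasureE tau0 Vv.
rewrite -integral_cst; last exact: measurable_itv.
apply: ge0_le_integral.
- exact: measurable_itv.
- by move=> u _; rewrite lee_fin.
- apply/measurable_EFinP; apply: measurable_funTS.
  exact: continuous_measurable_fun.
- exact: measurable_cst.
- by move=> u /=; rewrite in_itv/= => uI; rewrite lee_fin gM.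
Qed.

Lemma LSint_ge0 v (g : R -> R) : Vset tau v -> (forall u, 0 <= g u) ->
  (0 <= LSint tau v g)%E.
Proof.
move=> Vv g0; rewrite /LSint; have [F _ ->] := LSmeasureE tau0 Vv.
by apply: integral_ge0 => u _; rewrite lee_fin.
Qed.

Lemma Inphi_ge0 v : Vset tau v -> (0 <= Inphi n phi p tau v)%E.
Proof.
move=> Vv; apply: le_ereal_inf_tmp => _ [k _ <-]; apply: LSint_ge0 => // u.
exact: powR_ge0.
Qed.

Lemma Inphi_lty v : Vset tau v -> (Inphi n phi p tau v < +oo)%E.
Proof.
move=> Vv; have [B B0 kB] := kernel_fun_bounded.
apply: (@le_lt_trans _ _ (LSint tau v (kernel_fun n))).
  by apply: ereal_inf_lbound; exists n => //=.
apply: (le_lt_trans (LSint_cst_le (M := B) Vv _ _ _)).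
- exact: kernel_fun_continuous.
- exact: kernel_fun_ge0.
- by move=> u _; exact: kB.
- by rewrite -EFinM ltry.
Qed.

Lemma weighted_sum_Inphi f v (r : seq int) : Vset tau v -> Sp p f -> uniq r ->
  (forall k, k \in r -> (n <= `|k|)%N) ->
  (\sum_(k <- r) (cabs (fcoef f k) `^ p)%:E * Inphi n phi p tau v <=
   poweR (omega phi p f (tau / n%:R)) p * (v tau - v 0)%:E)%E.
Proof.
move=> Vv fS ur rn; set W := poweR _ p.
have W0 : (0 <= W)%E by exact: poweR_ge0.
have WE : W = (fine W)%:E.
  by rewrite fineK// ge0_fin_numE//; apply: poweR_lty; exact: omega_lty.
pose a k := cabs (fcoef f k) `^ p.
have a0 k : 0 <= a k by exact: powR_ge0.
pose G u := \sum_(k <- r) a k * kernel_fun `|k|%N u.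
apply: (@le_trans _ _ (LSint tau v G)).
  rewrite /LSint; have [F FE LF] := LSmeasureE tau0 Vv; rewrite LF.
  under eq_integral => u _ do rewrite /G -sumEFin.
  rewrite ge0_integral_sum//=.
  - rewrite big_seq [leRHS]big_seq; apply: lee_sum => k kr.
    under eq_integral => u _ do rewrite EFinM.
    rewrite ge0_integralZl_EFin//=.
    + rewrite lee_wpmul2l ?lee_fin//; apply: ereal_inf_lbound.
      by exists `|k|%N; [exact: rn|rewrite /LSint LF].
    + by move=> u _; rewrite lee_fin kernel_fun_ge0.
    + exact: measurable_kernel_fun.
  - move=> k; apply/measurable_EFinP; apply: measurable_funTS.
    apply: continuous_measurable_fun => u.
    by apply: cvgMr; exact: kernel_fun_continuous.
  - by move=> k u _; rewrite lee_fin mulr_ge0// kernel_fun_ge0.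
rewrite WE; apply: LSint_cst_le => //.
- move=> u; apply: cvg_big => [|k _]; first exact: add_continuous.
  by apply: cvgMr; exact: kernel_fun_continuous.
- by move=> u; apply: sumr_ge0 => k _; rewrite mulr_ge0// kernel_fun_ge0.
- move=> u /andP[u0 ut]; rewrite -lee_fin -WE /G -sumEFin.
  have hd : `|u / n%:R| <= tau / n%:R.
    by rewrite ger0_norm ?divr_ge0// ler_pM2r ?invr_gt0.
  apply: le_trans (Delta_le_omega f hd).
  apply: le_trans (sum_le_esum (r := r) _ _ _) => //.
  apply: lee_sum => k _; rewrite phi_kernel_fun mulrC ger0_norm ?divr_ge0//.
  by rewrite mulrCA mulfV ?gt_eqF// mulr1.
Qed.

Lemma Cratio_ge0 v : Vset tau v -> (0 <= Cratio n phi p tau v)%E.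
Proof.
move=> Vv; apply: mule_ge0; last by rewrite inve_ge0 Inphi_ge0.
by rewrite lee_fin subr_ge0 ltW// Vset_lt.
Qed.

Lemma tail_le_Cratio f v : Vset tau v -> Sp p f ->
  (0 < omega phi p f (tau / n%:R))%E ->
  (\esum_(k in [set k : int | (n <= `|k|)%N]) (cabs (fcoef f k) `^ p)%:E <=
   poweR (omega phi p f (tau / n%:R)) p * Cratio n phi p tau v)%E.
Proof.
move=> Vv fS w0; have I0 := Inphi_ge0 Vv.
have W0 : (0 < poweR (omega phi p f (tau / n%:R)) p)%E by exact: poweR_gt0.
rewrite /Cratio; case E : (Inphi n phi p tau v) I0 => [x| |] //; last first.
  by have := Inphi_lty Vv; rewrite E.
rewrite lee_fin le_eqVlt => /predU1P[<-|x0].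
  (* If [I(v) = 0], its inverse is [+oo] and so is the ratio, as [v 0 < v tau]; since [omega] is
     positive the right side is [+oo]. *)
  rewrite inve0 gt0_muley ?lte_fin ?subr_gt0 ?Vset_lt//.
  by rewrite gt0_muley// leey.
apply: esum_le => r ur rn; rewrite inver gt_eqF// muleA lee_pdivlMr// -E.
rewrite muleC ge0_sume_distrr => [|k _]; last by rewrite lee_fin powR_ge0.
under eq_bigr do rewrite muleC.
exact: weighted_sum_Inphi.
Qed.

Lemma En_le_Cconst f : Sp p f ->
  (En n p f <= Cconst n phi p tau * omega phi p f (tau / n%:R))%E.
Proof.
move=> fS; have [Lf _] := fS; have d0 : 0 < tau / n%:R by rewrite divr_gt0.
apply: (le_trans (En_le p0 n0 Lf)).
have := omega_ge0 f (ltW d0); rewrite le_eqVlt => /predU1P[w0|w0].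
  (* With [omega = 0] the right side is 0 even when [Cconst] is [+oo], so the tail itself must
     vanish. *)
  rewrite -w0 mule0 (_ : (\esum_(k in _) _)%E = 0%E).
    by rewrite poweR0r// invr_eq0 gt_eqF.
  apply: esum1 => k nk; rewrite (omega_eq0 d0 (esym w0)).
    by rewrite powR0// gt_eqF.
  by apply/eqP => k0; move: nk; rewrite k0 /= leqNgt n0.
set w := omega _ _ _ _ in w0 *.
have w_fin : w = (fine w)%:E.
  by rewrite fineK// ge0_fin_numE ?omega_lty// ltW.
have fw0 : 0 < fine w by rewrite -lte_fin -w_fin.
have Wp0 : 0 < fine w `^ p by rewrite powR_gt0.
rewrite /Cconst; set inf_ := ereal_inf _.
have inf0 : (0 <= inf_)%E.
  by apply: le_ereal_inf_tmp => _ [v Vv <-]; exact: Cratio_ge0.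
have -> : w = poweR (poweR w p) p^-1 by rewrite poweRK_root// ltW.
rewrite -poweRM ?poweR_ge0//.
apply: le_poweR; [by rewrite invr_ge0 ltW|exact: lpsum_ge0|].
(* Dividing by the finite positive power of [w] leaves a lower bound common to all ratios, hence for
   their infimum. *)
rewrite {1}w_fin poweR_EFin -lee_pdivrMr//.
apply: le_ereal_inf_tmp => _ [v Vv <-].
rewrite lee_pdivrMr// muleC -poweR_EFin -w_fin.
exact: tail_le_Cratio.
Qed.

Lemma Kconst_le_Cconst : (Kconst n phi p tau <= Cconst n phi p tau)%E.
Proof.
apply: ge_ereal_sup => _ [f [fS _] <-].
have d0 : 0 < tau / n%:R by rewrite divr_gt0.
have := En_le_Cconst fS.
have := omega_ge0 f (ltW d0); have := omega_lty (tau / n%:R) fS.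
case: (omega _ _ _ _) => [w _| |] //; rewrite lee_fin => w_ge0.
(* At [w = 0] the quotient is [0 / 0 = 0 * +oo = 0]. *)
have [->|w0] := eqVneq w 0.
  rewrite mule0 => E0; rewrite (_ : En n p f = 0%E) ?mul0e ?poweR_ge0//.
  by apply/eqP; rewrite eq_le E0 En_ge0.
have {}w0 : 0 < w by rewrite lt_neqAle eq_sym w0.
by rewrite inver gt_eqF// lee_pdivrMr.
Qed.

End upper_bound.

(** * Lower bound *)

Section lower_bound.
Context {R : realType} (p : R) (p1 : 1 <= p) (tau : R) (tau0 : 0 < tau).
Context (n : nat) (n0 : (0 < n)%N) (phi : R -> R) (hphi : Phi phi).
Local Open Scope complex_scope.

Let p0 : 0 < p. Proof. exact: lt_le_trans p1. Qed.
Let nR0 : 0 < n%:R :> R. Proof. by rewrite ltr0n. Qed.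

(** All frequencies are at least [n], so [En] keeps the full mass [\sum_i a i]. Positive frequencies
    suffice because the kernel depends on [|k|] only. *)
Definition extremal_poly N (a : 'I_N -> R) : R -> R[i] :=
  trig_sum (index_enum 'I_N) (fun i => (a i `^ p^-1)%:C) (fun i => Posz (n + i)).

Lemma fcoef_extremal_poly N (a : 'I_N -> R) (i : 'I_N) :
  fcoef (extremal_poly a) (Posz (n + i)) = (a i `^ p^-1)%:C.
Proof.
rewrite fcoef_trig_sum (bigD1 i)//= eqxx mulr1 big1 ?addr0// => j ji.
by rewrite eqz_nat eqn_add2l (negbTE (ji : val j != val i)) mulr0.
Qed.

Lemma fcoef_extremal_poly0 N (a : 'I_N -> R) k :
  k \notin [seq Posz (n + i) | i : 'I_N] -> fcoef (extremal_poly a) k = 0.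
Proof.
move=> kN; rewrite fcoef_trig_sum big1// => i _.
case: eqVneq => [E|_]; last by rewrite mulr0.
by move: kN; rewrite -E map_f// mem_enum.
Qed.

Let freq N := [seq Posz (n + i) | i : 'I_N].

Lemma freq_uniq N : uniq (freq N).
Proof. by rewrite map_inj_uniq ?enum_uniq// => i j [/addnI/val_inj]. Qed.

Lemma cabs_extremal_poly N (a : 'I_N -> R) (i : 'I_N) : 0 <= a i ->
  cabs (fcoef (extremal_poly a) (Posz (n + i))) `^ p = a i.
Proof.
move=> a0; rewrite fcoef_extremal_poly -[_%:C]mulr1 cabsMreal ?powR_ge0//.
rewrite /cabs ComplexField.Normc.normc1 mulr1 -powRrM mulVf ?gt_eqF//.
by rewrite powRr1.
Qed.

Lemma esum_extremal_poly N (a : 'I_N -> R) (w : int -> R) : (forall i, 0 <= a i) ->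
  (forall k, 0 <= w k) ->
  (\esum_(k in [set: int]) (w k * cabs (fcoef (extremal_poly a) k) `^ p)%:E =
   (\sum_i a i * w (Posz (n + i)))%:E)%E.
Proof.
move=> a0 w0; pose t k := (w k * cabs (fcoef (extremal_poly a) k) `^ p)%:E.
transitivity (\sum_(k <- freq N) t k)%E; last first.
  rewrite /freq big_map big_enum/= -sumEFin; apply: eq_bigr => i _.
  by rewrite /t cabs_extremal_poly// mulrC.
rewrite fsbig_seq ?freq_uniq// -esum_fset//; last first.
  by move=> k _; rewrite lee_fin mulr_ge0// powR_ge0.
rewrite [RHS]esum_mkcond; apply: eq_esum => k _; case: ifPn => //.
rewrite notin_setE => /negP kN; rewrite /t fcoef_extremal_poly0//.
by rewrite /cabs ComplexField.Normc.normc0 powR0 ?gt_eqF// mulr0.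
Qed.

Lemma Sp_extremal_poly N (a : 'I_N -> R) : (forall i, 0 <= a i) ->
  Sp p (extremal_poly a).
Proof.
move=> a0; split; first exact: Lper_trig_sum.
under eq_esum => k _ do rewrite -[_ `^ p]mul1r.
by rewrite esum_extremal_poly// ltry.
Qed.

(** Subtracting a constant, written as a [trig_sum] of frequency 0, does not affect coefficients at
    [n + i > 0]; if the difference vanished almost everywhere on a period, all [a i] would be 0. *)
Lemma nonconst_extremal_poly N (a : 'I_N -> R) : (forall i, 0 <= a i) ->
  0 < \sum_i a i -> nonconst (extremal_poly a).
Proof.
move=> a0 sa [c fc].
suff : \sum_i a i = 0 by move=> E; rewrite E ltxx in sa.
apply: big1 => i _; rewrite -[LHS](cabs_extremal_poly (a0 i)).
pose t := trig_sum [:: tt] (fun=> c) (fun=> 0 : int).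
have tE x : t x = c by rewrite /t /trig_sum big_seq1 mul0r /expi cos0 sin0 mulr1.
have Lf : Lper (extremal_poly a) by exact: Lper_trig_sum.
have := fcoef_sub_trig_sum [:: tt] (fun=> c) (fun=> 0 : int) (Posz (n + i)) Lf.
rewrite big_seq1 -/t (_ : 0 == Posz (n + i) = false) ?mulr0 ?subr0; last first.
  by apply/negbTE; move: n0; lia.
move=> <-; pose u x := trig_sum [:: tt] (fun=> - c) (fun=> 0 : int) x.
have uE x : extremal_poly a x - t x = extremal_poly a x + u x.
  by rewrite tE /u /trig_sum big_seq1 mul0r /expi cos0 sin0 mulr1.
rewrite (eq_fcoef _ uE) fcoef_ae_eq0.
- by rewrite /cabs ComplexField.Normc.normc0 powR0 ?gt_eqF.
- exact: (cint02piD (Lper_cint Lf) (cint_trig_sum _ _ _)).1.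
- apply: negligibleS fc => x /= nE E; apply: nE => xI.
  by rewrite -uE E// tE subrr.
Qed.

(** With [S = \sum_i a i], the test polynomial has p-th power of [En] at least [S] and p-th power of
    [omega] at most [m * S]. *)
Lemma Kconst_ge N (a : 'I_N -> R) (m : R) : (forall i, 0 <= a i) ->
  0 < \sum_i a i -> 0 < m ->
  (forall u, 0 <= u <= tau ->
     \sum_i a i * kernel_fun p n phi (n + i) u <= m * \sum_i a i) ->
  ((m `^ - p^-1)%:E <= Kconst n phi p tau)%E.
Proof.
move=> a0 sa m0 H; set S := \sum_i a i in sa H.
have Lf : Lper (extremal_poly a) by exact: Lper_trig_sum.
apply: (@le_trans _ _ (En n p (extremal_poly a) /
    omega phi p (extremal_poly a) (tau / n%:R))%E); last first.
  apply: ereal_sup_ubound; exists (extremal_poly a) => //; split; first exact: Sp_extremal_poly.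
  exact: nonconst_extremal_poly.
have EE : ((S `^ p^-1)%:E <= En n p (extremal_poly a))%E.
  apply: le_trans (En_ge p0 n0 Lf (freq_uniq N) _); last first.
    by move=> k /mapP[i _ ->]; rewrite absz_nat leq_addr.
  rewrite /freq big_map big_enum/=.
  under eq_bigr do rewrite cabs_extremal_poly//.
  by rewrite sumEFin poweR_EFin.
have d0 : 0 < tau / n%:R by rewrite divr_gt0.
have w_ge0 := omega_ge0 p phi (extremal_poly a) (ltW d0).
have wE : (omega phi p (extremal_poly a) (tau / n%:R) <= ((m * S) `^ p^-1)%:E)%E.
  apply: ge_ereal_sup => _ [h /= hd <-]; rewrite -poweR_EFin.
  apply: le_poweR; [by rewrite invr_ge0 ltW|exact: lpsum_ge0|].
  under eq_esum do rewrite (cabs_Delta p hphi).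
  rewrite esum_extremal_poly => [|//|k]; last exact: powR_ge0.
  rewrite lee_fin; apply: le_trans (H (n%:R * `|h|) _); last first.
    by rewrite mulr_ge0//= mulrC -ler_pdivlMr.
  apply: ler_sum => i _; rewrite (phi_kernel_fun _ n0 hphi) absz_nat.
  exact: lexx.
have -> : ((m `^ - p^-1)%:E = (S `^ p^-1)%:E * ((m * S) `^ p^-1)%:E^-1)%E.
  rewrite inver gt_eqF ?powR_gt0 ?mulr_gt0// -EFinM powRM ?(ltW m0) ?(ltW sa)//.
  by rewrite invfM mulrCA mulfV ?mulr1 ?gt_eqF ?powR_gt0// powRN.
apply: lee_pmul => //; first by rewrite lee_fin powR_ge0.
  by rewrite inver gt_eqF ?powR_gt0 ?mulr_gt0// lee_fin invr_ge0 powR_ge0.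
by rewrite lee_pV2// inE lee_fin powR_ge0.
Qed.

Lemma Kconst_gt0 : (0 < Kconst n phi p tau)%E.
Proof.
have [B B0 kB] := kernel_fun_bounded p1 n hphi.
have := @Kconst_ge 1 (fun=> 1) B _ _ B0; rewrite big_ord1.
move=> /(_ (fun=> ler01) ltr01) H; apply: lt_le_trans (H _).
  by rewrite lte_fin powR_gt0.
by move=> u _; rewrite big_ord1 mul1r mulr1.
Qed.

Lemma id_Vset : Vset tau id.
Proof.
split; first by move=> x y.
split.
  exists tau => x; rewrite in_itv/= => /andP[x0 xt].
  by rewrite ger0_norm.
exists 0, tau; rewrite !in_itv/= !lexx ltW//; split => //; split => //.
by rewrite lt_eqF.
Qed.

Lemma exists_optimal_distribution (K : R) : Kconst n phi p tau = K%:E ->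
  exists2 v, Vset tau v & (Cratio n phi p tau v <= (K `^ p)%:E)%E.
Proof.
move=> KE; have K0 : 0 < K by rewrite -lte_fin -KE Kconst_gt0.
have [B B0 kB] := kernel_fun_bounded p1 n hphi.
pose mu := (K `^ p)^-1; have mu0 : 0 < mu by rewrite invr_gt0 powR_gt0.
have [|||| v [Vv v0 vt Hv]] := @optimal_distribution _ tau
    (fun k => kernel_fun p n phi (n + k)) B mu tau0.
- by move=> k; exact: kernel_fun_continuous.
- by move=> k u; rewrite kernel_fun_ge0 kB.
- by move=> k; exact: kernel_fun0.
- move=> mu' N a mu'mu a0; apply: contrapT => H.
  have sa0 : 0 <= \sum_k a k by exact: sumr_ge0.
  have Hu u : 0 <= u <= tau ->
      \sum_i a i * kernel_fun p n phi (n + i) u < mu' * \sum_k a k.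
    by move=> uI; rewrite ltNge; apply/negP => ?; apply: H; exists u.
  have : 0 < mu' * \sum_k a k.
    apply: le_lt_trans (Hu 0 _); last by rewrite lexx ltW.
    by apply: sumr_ge0 => i _; rewrite mulr_ge0// kernel_fun_ge0.
  have [->|sa] := eqVneq (\sum_k a k) 0; first by rewrite mulr0 ltxx.
  have {}sa : 0 < \sum_k a k by rewrite lt_neqAle eq_sym sa.
  rewrite pmulr_lgt0// => mu'0.
  have := Kconst_ge a0 sa mu'0 (fun u uI => ltW (Hu u uI)).
  rewrite KE lee_fin leNgt => /negP; apply.
  have -> : K = mu `^ - p^-1.
    by rewrite /mu -powRN -powRrM mulrNN mulfV ?gt_eqF// powRr1// ltW.
  rewrite !powRN ltf_pV2 ?posrE ?powR_gt0//.
  by apply: gt0_ltr_powR; rewrite ?nnegrE ?invr_gt0// ltW.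
exists v => //.
have I0 : (mu%:E <= Inphi n phi p tau v)%E.
  apply: le_ereal_inf_tmp => _ [k nk <-].
  by have := Hv (k - n)%N; rewrite subnKC.
rewrite /Cratio vt v0 subr0 mul1e -[K `^ p]invrK -/mu.
have -> : (mu^-1%:E = mu%:E^-1)%E by rewrite inver gt_eqF.
by rewrite lee_pV2// inE ?lee_fin ?(ltW mu0)//; exact: Inphi_ge0.
Qed.

End lower_bound.

Theorem theorem2 (R : realType) (p : R) (hp : 1 <= p) (tau : R) (htau : 0 < tau)
    (n : nat) (hn : (0 < n)%N) (phi : R -> R) (hphi : Phi phi) :
  (forall f : R -> R[i], Sp p f ->
     (En n p f <= Cconst n phi p tau * omega phi p f (tau / n%:R))%E) /\
  (exists2 vstar : R -> R, Vset tau vstar &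
     Cratio n phi p tau vstar = ereal_inf [set Cratio n phi p tau v | v in Vset tau]) /\
  Kconst n phi p tau = Cconst n phi p tau.
Proof.
split; first by move=> f; exact: En_le_Cconst.
have p0 : 0 < p by exact: lt_le_trans hp.
have KC := Kconst_le_Cconst hp htau hn hphi.
have K0 := Kconst_gt0 hp htau hn hphi.
set inf_ := ereal_inf _.
have infle v : Vset tau v -> (inf_ <= Cratio n phi p tau v)%E.
  by move=> Vv; apply: ereal_inf_lbound; exists v.
have inf0 : (0 <= inf_)%E.
  by apply: le_ereal_inf_tmp => _ [v Vv <-]; exact: Cratio_ge0.
case E : (Kconst n phi p tau) => [K| |]; last by move: K0; rewrite E.
- have [v Vv vK] := exists_optimal_distribution hp htau hn hphi E.
  (* The circle [K^p <= inf_ <= Cratio v <= K^p] gives attainment and [K = C] together. *)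
  have Kinf : ((K `^ p)%:E <= inf_)%E.
    rewrite -poweR_EFin -E -(poweR_rootK p0 inf0).
    by apply: le_poweR; [exact: ltW|exact: ltW|exact: KC].
  have Einf : inf_ = (K `^ p)%:E.
    by apply/eqP; rewrite eq_le Kinf (le_trans (infle v Vv)).
  split; first by exists v => //; apply/eqP; rewrite eq_le infle// Einf vK.
  rewrite /Cconst -/inf_ Einf poweR_EFin -powRrM mulfV ?gt_eqF// powRr1//.
  by rewrite -lee_fin -E ltW.
(* If [K] is infinite, so are [C] and every ratio; any member of [Vset tau], such as the identity,
   attains the infimum. *)
- have Cy : Cconst n phi p tau = +oo%E by apply/eqP; rewrite -leye_eq -E.
  split => //; exists id; first exact: id_Vset.
  have infy : inf_ = +oo%E by apply: (@poweR_eqy _ _ p^-1).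
  by apply/eqP; rewrite eq_le infle ?infy ?leey//; exact: id_Vset.
Qed.
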